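(* Let $(\Sigma_P,\theta,\mu)$ be a Markov shift over a finite alphabet. Let $x=(x_1,x_2,\dots)\in\Sigma_P$ be a periodic point of prime period $p$ such that $(x_1,\dots,x_p)$ is a reduced word and the local escape rate $\rho(x,\mathbbm{1})$ exists. Let $A_\nu=[x_1,\dots,x_{\nu p}]$ and $\mu_\nu=\mu(A_\nu)$ for $\nu\in\mathbb{N}$. Let $\varphi$ be a ceiling function that is a cylinder function. Then, as $\nu\to\infty$, \[\rho(A_\nu,\varphi)=\frac{1-c_o}{\mu(\varphi)}\mu_\nu+\Big(\frac{1-c_o}{\mu(\varphi)}\Big)^2S_p\varphi(x)\,\nu\,\mu_\nu^2+o(\nu\mu_\nu^2),\] where $c_o=p_{x_1,x_2}\cdots p_{x_p,x_{p+1}}$.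
   Context: Markov shift: $P=(p_{a,b})$ non-negative irreducible row-stochastic on a finite set $S$, $\Sigma_P=\{y\in S^{\mathbb{N}}:p_{y_i,y_{i+1}}>0\ \forall i\}$, $\theta$ the shift, $\pi$ the positive stationary probability vector, $\mu([a_1,\dots,a_n])=\pi_{a_1}\prod_{i<n}p_{a_i,a_{i+1}}$; metric $d(y,y')=e^{-\beta|y\wedge y'|}$ for some $\beta>0$ ($|y\wedge y'|$ the length of the common prefix). A word $(a_1,\dots,a_m)$ is reduced if there is $a_m'\ne a_m$ with $(a_1,\dots,a_{m-1},a_m')$ admissible. A cylinder function is a function constant on each $n$-cylinder for some $n$; a ceiling function is a measurable $\varphi$ with $\inf\varphi>0$; $\mu(\varphi)=\int\varphi\,d\mu$; $S_j\varphi=\sum_{i<j}\varphi\circ\theta^i$. Special flow: $N_t(y)=\min\{j\ge0:S_j\varphi(y)>t\}$, $\overline{X}=\{(y,s):0\le s<\varphi(y)\}$ with $\overline{\mu}$ the restriction of $\mu\otimes$Lebesgue, $\Phi_t(y,s)=(y,s+t)$ if $t<\varphi(y)-s$, else $(\theta^{N-1}y,s+t-S_{N-1}\varphi(y))$, $N=N_{s+t}(y)$. For a hole $A$ (measurable, $\bigcup_j\theta^{-j}A=\Sigma_P$ a.e.), $\rho(A,\varphi)=\lim_{t\to\infty}-\frac1t\log\overline{\mu}(\{(y,s):\forall\tau\in[0,t]:\Phi_\tau(y,s)\notin A\times\mathbb{R}\})$; the local escape rate is $\rho(x,\varphi)=\lim_{r\to0}\rho(B_r(x),\varphi)/\mu(B_r(x))$,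 and $\mathbbm{1}$ is the constant function $1$. *)

(* Defs.v *)
From HB Require Import structures.
From mathcomp Require Import all_boot all_order all_algebra.
From mathcomp Require Import all_classical all_reals all_analysis.
Set Implicit Arguments. Unset Strict Implicit. Unset Printing Implicit Defensive.
Import Order.TTheory GRing.Theory Num.Theory.
Import numFieldNormedType.Exports.
Local Open Scope classical_set_scope.
Local Open Scope ring_scope.

(* The carrier S^N; s0 is only used to equip it with a default point,
   as required by MathComp-Analysis' measurable structures. *)
Definition seqsp (S : finType) (s0 : S) : Type := nat -> S.
HB.instance Definition _ (S : finType) (s0 : S) :=
  Choice.copy (seqsp s0) (nat -> S).
HB.instance Definition _ (S : finType) (s0 : S) :=
  isPointed.Build (seqsp s0) (fun _ => s0).

Definition agree (S : Type) (y y' : nat -> S) (n : nat) : Prop :=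
  forall i, (i < n)%N -> y i = y' i.

Definition cyl (S : finType) (s0 : S) (w : nat -> S) (n : nat) : set (seqsp s0) :=
  [set y | agree y w n].
Arguments cyl {S} s0 w n.

Definition cylinders (S : finType) (s0 : S) : set (set (seqsp s0)) :=
  [set C | exists w n, C = cyl s0 w n].
Arguments cylinders {S} s0.

Notation Sigma s0 := (g_sigma_algebraType (cylinders s0)).

Definition sshift (T : Type) (y : nat -> T) : nat -> T := fun n => y n.+1.

Definition stochastic (R : realType) (S : finType) (P : S -> S -> R) : Prop :=
  (forall a b, 0 <= P a b) /\ (forall a, \sum_(b : S) P a b = 1).

Definition irreducible (R : realType) (S : finType) (P : S -> S -> R) : Prop :=
  forall a b, exists s : seq S, path (fun u v => 0 < P u v) a s /\ last a s = b.

Definition stationary_prob (R : realType) (S : finType) (P : S -> S -> R)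
  (pi : S -> R) : Prop :=
  (forall a, 0 < pi a) /\ \sum_(a : S) pi a = 1 /\
  (forall b, \sum_(a : S) pi a * P a b = pi b).

Definition admissible_word (R : realType) (S : finType) (P : S -> S -> R)
  (w : nat -> S) (m : nat) : Prop :=
  forall i, (i.+1 < m)%N -> 0 < P (w i) (w i.+1).

Definition reduced_word (R : realType) (S : finType) (P : S -> S -> R)
  (w : nat -> S) (m : nat) : Prop :=
  exists a' : S, a' <> w m.-1 /\
    admissible_word P (fun i => if i == m.-1 then a' else w i) m.

Definition SigmaP (R : realType) (S : finType) (P : S -> S -> R) : set (nat -> S) :=
  [set y | forall i, 0 < P (y i) (y i.+1)].

Definition markov_measure (R : realType) (S : finType) (s0 : S)
  (P : S -> S -> R) (pi : S -> R) (mu : set (Sigma s0) -> \bar R) : Prop :=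
  forall (w : nat -> S) (n : nat),
    mu (cyl s0 w n.+1) = (pi (w 0%N) * \prod_(i < n) P (w i) (w i.+1))%:E.

(* open ball for d(y,y') = exp(-beta |y /\ y'|) :
   d(x,y) < r  iff  for every k with exp(-beta k) >= r, |x /\ y| > k *)
Definition ball_d (R : realType) (S : finType) (s0 : S) (beta : R)
  (x : Sigma s0) (r : R) : set (Sigma s0) :=
  [set y | forall k : nat, r <= expR (- (beta * k%:R)) -> agree y x k.+1].

Definition cylinder_fun (R : realType) (S : finType) (s0 : S)
  (phi : Sigma s0 -> R) : Prop :=
  exists n, forall y y' : Sigma s0, agree y y' n -> phi y = phi y'.

Definition ceiling_fun (R : realType) (S : finType) (s0 : S)
  (phi : Sigma s0 -> R) : Prop :=
  measurable_fun setT phi /\ exists c : R, 0 < c /\ forall y, c <= phi y.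

Section SpecialFlow.
Variables (R : realType) (T : Type) (theta : T -> T) (phi : T -> R).

Definition birk (j : nat) (y : T) : R := \sum_(i < j) phi (iter i theta y).

Definition Nt (t : R) (y : T) : nat :=
  xget 0%N [set j | t < birk j y /\ forall i, (i < j)%N -> birk i y <= t].

Definition flow (t : R) (ys : T * R) : T * R :=
  let: (y, s) := ys in
  if t < phi y - s then (y, s + t)
  else let N := Nt (s + t) y in (iter N.-1 theta y, s + t - birk N.-1 y).

Definition survivors (A : set T) (t : R) : set (T * R) :=
  [set ys | (0 <= ys.2 /\ ys.2 < phi ys.1) /\
            forall tau, 0 <= tau -> tau <= t -> ~ A (flow tau ys).1].

End SpecialFlow.

(* rho(A, phi) = lim_{t -> oo} -1/t log mubar(survivors) exists and equals rho,
   where mubar = (mu x Lebesgue) restricted to X-bar (survivors lie in X-bar) *)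
Definition is_escape_rate (R : realType) (S : finType) (s0 : S)
  (mu : {measure set (Sigma s0) -> \bar R}) (A : set (Sigma s0))
  (phi : Sigma s0 -> R) (rho : R) : Prop :=
  (fun t : R => - (ln (fine ((mu \x lebesgue_measure)%E
                     (survivors (@sshift S) phi A t))) / t))
    @ +oo --> rho.

Definition local_escape_rate_exists (R : realType) (S : finType) (s0 : S)
  (mu : {measure set (Sigma s0) -> \bar R}) (beta : R) (x : Sigma s0)
  (phi : Sigma s0 -> R) : Prop :=
  exists (L : R) (f : R -> R),
    (\forall r \near 0^'+, is_escape_rate mu (ball_d beta x r) phi (f r)) /\
    (fun r => f r / fine (mu (ball_d beta x r))) @ 0^'+ --> L.

(* Main.v *)
Require Import Defs.
From HB Require Import structures.
From mathcomp Require Import all_boot all_order all_algebra.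
From mathcomp Require Import all_classical all_reals all_analysis.
From mathcomp Require Import measurable_realfun.
From mathcomp Require Import ring lra zify.
Import Order.TTheory GRing.Theory Num.Theory.
Import numFieldNormedType.Exports.
Local Open Scope classical_set_scope.
Local Open Scope ring_scope.

(* The escape rate is the exact root s of an explicit equation. Let phi depend on n
   letters, with p dividing n, and let A be the word x_1 ... x_(n + N p). Let
   d(s) = E exp(s S_T phi) - 1, where T is the return time to the n-block of x. A
   gambling martingale for the occurrence of A, weighted by exp(s S_j phi), vanishes
   when A is completed if and only if d(s) * sum_(1 <= q <= N) k^(-q) = 1, where
   k = c_o exp(s S_p phi(x)); here the prime period controls the overlaps of A with
   itself. Reducedness keeps the martingale between two positive constants before
   the completion, so optional stopping at S_j > t gives survival probabilities
   comparable to exp(- s t), and s is the escape rate. Kac's formula,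
   d(s) = s mu(phi) / mu(n-block) + O(s^2), then turns the equation into the
   expansion; its second term comes from the factor exp(s S_p phi(x))^N in k^N. *)

(** All errors come from one scalar equation: for large [N] the rate is exactly its root, and no
    transfer operator is perturbed. Working with [n]-blocks makes [phi] a function of the state of a
    finite chain, so the return expectation [F] solves a linear system that is invertible for small
    [s]. The stake is forced: entering the block of [x] counts as 1 in the recursion of [F], and the
    surplus [F - 1] there must be carried by a new bet. The value 0 at completion makes the stopped
    expectation charge survivors only. The delicate point is a positive lower bound before
    completion, whatever the current overlap: a partial overlap costs at most the weighted
    transitions of a final piece of one period, and the last of them has probability below 1.
    Passing to the flow shifts time by a bounded amount, hence changes constants only. Finally
    [nu = N + m + 1], where [phi] reads [m] letters; replacing [N] by [nu] costs a term of order
    [mu_nu ^ 2], negligible against [nu * mu_nu ^ 2]. *)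

Section ExpBounds.
Context {R : realType}.
Implicit Types z : R.

Lemma expR_le_inv1B z : z < 1 -> expR z <= (1 - z)^-1.
Proof.
move=> z1; rewrite -[z in expR z]opprK expRN lef_pV2 ?posrE ?expR_gt0 ?subr_gt0//.
by have := expR_ge1Dx (- z).
Qed.

Lemma expR_sub1_le2 z : 0 <= z -> z <= 2^-1 -> expR z - 1 <= 2 * z.
Proof.
move=> z0 z1; have := @expR_le_inv1B z ltac:(lra) => h.
have z2 : 0 < 1 - z by lra.
have : (1 - z)^-1 <= 1 + 2 * z by rewrite -[leLHS]mul1r ler_pdivrMr//; nra.
lra.
Qed.

Lemma expR_sub1D_le z : 0 <= z -> z <= 2^-1 -> expR z <= 1 + z + 2 * z ^+ 2.
Proof.
move=> z0 z1; have := @expR_le_inv1B z ltac:(lra) => h.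
have z2 : 0 < 1 - z by lra.
have : (1 - z)^-1 <= 1 + z + 2 * z ^+ 2.
  by rewrite -[leLHS]mul1r ler_pdivrMr// expr2; nra.
lra.
Qed.

Lemma onem_expRN_le z : 1 - expR (- z) <= z.
Proof. by have := expR_ge1Dx (- z); lra. Qed.

Lemma onem_expRN_ge z : 0 <= z -> z - z ^+ 2 <= 1 - expR (- z).
Proof.
move=> z0; have := @expR_le_inv1B (- z) ltac:(lra); rewrite opprK => h.
have z2 : 0 < 1 + z by lra.
have : (1 + z)^-1 <= 1 - z + z ^+ 2.
  by rewrite -[leLHS]mul1r ler_pdivrMr// expr2; nra.
lra.
Qed.

End ExpBounds.

(** * Continuity of determinants and of Cramer's rule *)

Lemma continuous_det (K : numFieldType) (T : topologicalType) n
    (M : T -> 'M[K]_n) (x : T) :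
  (forall i j, M t i j @[t --> x] --> M x i j) ->
  \det (M t) @[t --> x] --> \det (M x).
Proof.
move=> cM; apply: (@cvg_big _ _ +%R 0 xpredT) => [|s _]; first exact: add_continuous.
apply: cvgM; first exact: cvg_cst.
by apply: (@cvg_big (K : topologicalType) _ *%R 1 xpredT) => [|i _]; [exact: mul_continuous|exact: cM].
Qed.

Lemma continuous_invmx (K : numFieldType) (T : topologicalType) n
    (M : T -> 'M[K]_n) (x : T) i j :
  (forall i j, M t i j @[t --> x] --> M x i j) -> \det (M x) != 0 ->
  (\det (M t))^-1 * (\adj (M t)) i j @[t --> x] -->
  (\det (M x))^-1 * (\adj (M x)) i j.
Proof.
move=> cM dM; apply: cvgM; first by apply: cvgV => //; exact: continuous_det.
rewrite mxE; under eq_cvg do rewrite mxE.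
apply: cvgM; first exact: cvg_cst.
apply: continuous_det => k l.
by rewrite !mxE; under eq_cvg do rewrite !mxE; exact: cM.
Qed.

(** * Generating function of the return time of a finite chain *)

Section ReturnTime.
Context {R : realType} {V S : finType}.
Variables (nxt : V -> S -> V) (w : V -> S -> R) (star : V).

Fixpoint wpath (u : V) (l : seq S) : bool :=
  if l is b :: l' then (0 < w u b) && wpath (nxt u b) l' else true.

Hypothesis w_ge0 : forall u b, 0 <= w u b.
Hypothesis w_sum1 : forall u, \sum_b w u b = 1.
Hypothesis reach : forall u, exists l, wpath u l /\ foldl nxt u l = star.

Definition kill (v : V -> R) (u : V) : R := if u == star then 0 else v u.

(** Maximum principle: a maximum of [|v|] propagates along every transition of positive weight and
    can never enter [star], where the killed value is 0; but [star] is reachable from everywhere. *)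
Lemma harmonic_kill_eq0 (v : V -> R) :
  (forall u, v u = \sum_b w u b * kill v (nxt u b)) -> forall u, v u = 0.
Proof.
move=> hv.
have [u0 _ u0max] := Order.TotalTheory.arg_maxP (fun i => `|v i|) (erefl true : xpredT star).
have {}u0max u : `|v u| <= `|v u0| by exact: u0max.
have [v0|v0] := eqVneq (v u0) 0.
  by move=> u; apply/eqP; rewrite -normr_eq0 eq_le normr_ge0 andbT -(normr0 R) -v0.
have M0 : 0 < `|v u0| by rewrite normr_gt0.
have killle u : `|kill v u| <= `|v u0| by rewrite /kill; case: ifP => // _; rewrite normr0 ltW.
have step u b : `|v u| = `|v u0| -> 0 < w u b ->
    nxt u b != star /\ `|v (nxt u b)| = `|v u0|.
  move=> vu wb.
  have : \sum_b w u b * (`|v u0| - `|kill v (nxt u b)|) <= 0.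
    under eq_bigr do rewrite mulrBr.
    rewrite sumrB -mulr_suml w_sum1 mul1r subr_le0 -vu hv.
    apply: (le_trans (ler_norm_sum _ _ _)); apply: ler_sum => c _.
    by rewrite normrM (ger0_norm (w_ge0 u c)).
  have h0 c : xpredT c -> 0 <= w u c * (`|v u0| - `|kill v (nxt u c)|).
    by move=> _; rewrite mulr_ge0// subr_ge0.
  move=> le0.
  have /(psumr_eq0P h0) : \sum_b w u b * (`|v u0| - `|kill v (nxt u b)|) = 0.
    by apply/eqP; rewrite eq_le le0 sumr_ge0.
  move=> /(_ b isT) /eqP; rewrite mulf_eq0 gt_eqF//= subr_eq0 => /eqP.
  rewrite /kill; case: eqP => [_|_ <-//].
  by rewrite normr0 => h; move: M0; rewrite h ltxx.
have never l : forall u, u != star -> `|v u| = `|v u0| -> wpath u l ->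
    foldl nxt u l != star.
  elim: l => //= b l ih u _ vu /andP[wb wl].
  by have [h1 h2] := step _ _ vu wb; exact: ih.
(* The maximum may sit at [star] itself, so one step is made before [never] is applied. *)
have [b wb] : exists b, 0 < w u0 b.
  apply/existsP; apply: contraT; rewrite negb_exists => /forallP h.
  have := w_sum1 u0; rewrite big1 => [/esym/eqP|b _]; first by rewrite oner_eq0.
  by apply/eqP; rewrite eq_le w_ge0 andbT leNgt h.
have [h1 h2] := step u0 b erefl wb.
have [l [wl lE]] := reach (nxt u0 b).
by have := never l _ h1 h2 wl; rewrite lE eqxx.
Qed.

Variables (f : V -> R).
Hypothesis f_ge0 : forall u, 0 <= f u.

(** The system for [D = F - 1]: columns at [star] are killed, and [A s] applied to [D] equals
    [exp (s f) - 1] exactly when [1 + D] satisfies the first-step recursion of the hitting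
    expectation. It is regular at [s = 0] by the maximum principle, hence near 0. *)
Let A (s : R) : 'M[R]_#|V| := \matrix_(i, j) ((i == j)%:R -
  expR (s * f (enum_val i)) * \sum_b w (enum_val i) b *
   ((nxt (enum_val i) b == enum_val j) && (enum_val j != star))%:R).

Let A_mul s (v : V -> R) i :
  (A s *m \col_j v (enum_val j)) i 0 = v (enum_val i) -
    expR (s * f (enum_val i)) * \sum_b w (enum_val i) b * kill v (nxt (enum_val i) b).
Proof.
rewrite !mxE; under eq_bigr do rewrite !mxE mulrBl.
rewrite sumrB; congr (_ - _).
  rewrite (bigD1 i)//= eqxx mul1r big1 ?addr0// => j ji.
  by rewrite eq_sym (negbTE ji) mul0r.
under eq_bigr do rewrite -mulrA mulr_suml.
rewrite -mulr_sumr exchange_big/=; congr (_ * _); apply: eq_bigr => b _.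
rewrite (bigD1 (enum_rank (nxt (enum_val i) b)))//= enum_rankK eqxx big1 ?addr0.
  by rewrite /kill -mulrA; case: ifP => _; rewrite ?mul0r ?mul1r ?mulr0.
move=> j jn; rewrite (_ : (nxt _ _ == _) = false) ?mulr0 ?mul0r//.
by apply: contraNF jn => /eqP ->; rewrite enum_valK.
Qed.

Let A_cont s0 i j : A s i j @[s --> s0] --> A s0 i j.
Proof.
rewrite mxE; under eq_cvg do rewrite mxE.
apply: cvgB; first exact: cvg_cst.
apply: cvgM; last exact: cvg_cst.
apply: (@cvg_comp _ _ _ (fun s => s * _) expR); last exact: continuous_expR.
by apply: cvgM => //; exact: cvg_cst.
Qed.

Let A0_det : \det (A 0) != 0.
Proof.
apply/negP; rewrite -det_tr => /det0P[v v0 vA].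
have hA : A 0 *m v^T = 0 by rewrite -[A 0]trmxK -trmx_mul vA trmx0.
pose g (u : V) : R := v 0 (enum_rank u).
have gE : v^T = \col_j g (enum_val j).
  by apply/matrixP => i j; rewrite !mxE /g enum_valK ord1.
have : forall u, g u = 0.
  apply: harmonic_kill_eq0 => u.
  have := A_mul 0 g (enum_rank u); rewrite -gE hA mxE enum_rankK mul0r expR0 mul1r.
  by move/eqP; rewrite eq_sym subr_eq0 => /eqP.
move=> g0; case/eqP: v0; apply/rowP => j.
by have := g0 (enum_val j); rewrite /g enum_valK mxE.
Qed.

Let D s u : R := \sum_j (\det (A s))^-1 * (\adj (A s)) (enum_rank u) j *
                     (expR (s * f (enum_val j)) - 1).

Let D_eq s u : \det (A s) != 0 ->
  D s u - expR (s * f u) * (\sum_b w u b * kill (D s) (nxt u b)) = expR (s * f u) - 1.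
Proof.
move=> dA; have := A_mul s (D s) (enum_rank u); rewrite !enum_rankK => <-.
pose r : 'cV[R]_#|V| := \col_j (expR (s * f (enum_val j)) - 1).
rewrite (_ : (\col_j _) = (\det (A s))^-1 *: (\adj (A s)) *m r); last first.
  apply/colP => i; rewrite !mxE; apply: eq_bigr => j _.
  by rewrite !mxE enum_valK.
by rewrite mulmxA -scalemxAr mul_mx_adj scale_scalar_mx mulVf// mul1mx mxE enum_rankK.
Qed.

Let D_cont s0 u : \det (A s0) != 0 -> D s u @[s --> s0] --> D s0 u.
Proof.
move=> dA; apply: (@cvg_big _ _ +%R 0 xpredT) => [|j _]; first exact: add_continuous.
apply: cvgM; first by apply: continuous_invmx => // i k; exact: A_cont.
apply: cvgB; last exact: cvg_cst.
apply: (@cvg_comp _ _ _ (fun s => s * _) expR); last exact: continuous_expR.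
by apply: cvgM => //; exact: cvg_cst.
Qed.

(** Near 0 the entries of the inverse stay bounded by continuity, while the right-hand side
    [exp (s f) - 1] is of order [s]. *)
Let D_bound : exists s0 C : R, [/\ 0 < s0, 0 <= C & forall s, 0 <= s -> s <= s0 ->
  \det (A s) != 0 /\ forall u, `|D s u| <= C * s].
Proof.
have near_det : \forall s \near (0 : R), \det (A s) != 0.
  have cdet : \det (A s) @[s --> (0 : R)] --> \det (A 0).
    by apply: continuous_det => i j; exact: A_cont.
  exact: (cvgr_neq0 _ cdet A0_det).
pose e (s : R) i j := (\det (A s))^-1 * (\adj (A s)) i j.
pose C1 := 1 + \sum_i \sum_j `|e 0 i j|.
have near_e : \forall s \near (0 : R), forall i j, `|e s i j| <= C1.
  have ce i j : e s i j @[s --> (0 : R)] --> e 0 i j.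
    by apply: (@continuous_invmx _ _ _ A 0 i j) => // k l; exact: A_cont.
  have C1_gt i j : `|e 0 i j| < C1.
    rewrite /C1 (bigD1 i)//= (bigD1 j)//=.
    set a := `|_|; set b := \sum_(_ | _) _; set c := \sum_(_ | _) _.
    have : 0 <= b by exact: sumr_ge0.
    have : 0 <= c by apply: sumr_ge0 => k _; exact: sumr_ge0.
    lra.
  apply: (@filter_forall _ _ (fun i s => forall j, `|e s i j| <= C1) (nbhs (0 : R)) _) => i.
  apply: (@filter_forall _ _ (fun j s => `|e s i j| <= C1) (nbhs (0 : R)) _) => j.
  exact: (cvgr_norm_le _ (ce i j) _ (C1_gt i j)).
have C10 : 0 <= C1 by rewrite /C1 addr_ge0// sumr_ge0// => k _; rewrite sumr_ge0.
have [r /= r0 hr] := (nbhs_ballP _ _).1 (filterI near_det near_e).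
pose Fm := \sum_u f u.
have Fm0 : 0 <= Fm by exact: sumr_ge0.
have f_le u : f u <= Fm by rewrite /Fm (bigD1 u)//= lerDl sumr_ge0.
(* The first bound on [s] keeps it inside the ball where [A s] is regular; the second gives
   [s * f u <= 1/2], as [expR_sub1_le2] requires. *)
exists (Num.min (r / 2) (2 * (Fm + 1))^-1), (\sum_(j < #|V|) C1 * (2 * Fm)).
split; first by rewrite lt_min divr_gt0//= invr_gt0; nra.
  by apply: sumr_ge0 => j _; nra.
move=> s s0; rewrite le_min => /andP[sr sF].
have [dA he] : [set s | \det (A s) != 0] s /\ forall i j, `|e s i j| <= C1.
  by apply: hr; rewrite /ball/= sub0r normrN ger0_norm//; lra.
split=> // u; apply: (le_trans (ler_norm_sum _ _ _)); rewrite mulr_suml.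
apply: ler_sum => j _; rewrite normrM -mulrA ler_pM//; first exact: he.
have sf0 : 0 <= s * f (enum_val j) by rewrite mulr_ge0.
have sf : s * f (enum_val j) <= s * Fm by rewrite ler_wpM2l.
have sFm : s * Fm <= 2^-1.
  have h : 0 < 2 * (Fm + 1) by nra.
  move: sF; rewrite -[leRHS]mul1r ler_pdivlMr//; nra.
rewrite ger0_norm; last by rewrite subr_ge0 -expR0 ler_expR.
have := @expR_sub1_le2 _ (s * f (enum_val j)) sf0 ltac:(lra); lra.
Qed.

Variable pv : V -> R.
Hypothesis pv_ge0 : forall u, 0 <= pv u.
Hypothesis pv_inv : forall G : V -> R,
  \sum_u pv u * \sum_b w u b * G (nxt u b) = \sum_u pv u * G u.

(* [F s u] is the generating function [E_u exp (s S_T f)] of the time-weighted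
   hitting time [T >= 1] of [star]; the bound on [F s star - 1] is Kac's formula
   at first order in [s]. *)
Lemma return_gf_exists : exists (s0 C B : R) (F : R -> V -> R),
  [/\ 0 < s0, 0 <= C, 0 <= B & forall s, 0 <= s -> s <= s0 ->
  [/\ forall u, F s u = expR (s * f u) *
        \sum_b w u b * (if nxt u b == star then 1 else F s (nxt u b)),
      forall u, `|F s u - 1| <= C * s,
      `|pv star * (F s star - 1) - s * \sum_u pv u * f u| <= B * s ^+ 2 &
      forall u, F t u @[t --> s] --> F s u]].
Proof.
have [s0 [C [s00 C0 hD]]] := D_bound.
exists s0, C, (\sum_u pv u * (C * f u + f u ^+ 2)), (fun s u => 1 + D s u).
split=> //; first by apply: sumr_ge0 => u _; rewrite mulr_ge0// addr_ge0 ?sqr_ge0// mulr_ge0.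
move=> s s_ge0 ss0; have [dA Db] := hD s s_ge0 ss0.
have rec u : 1 + D s u = expR (s * f u) *
    \sum_b w u b * (if nxt u b == star then 1 else 1 + D s (nxt u b)).
  have -> : \sum_b w u b * (if nxt u b == star then 1 else 1 + D s (nxt u b)) =
      1 + \sum_b w u b * kill (D s) (nxt u b).
    rewrite -[X in X + _](w_sum1 u) -big_split/=; apply: eq_bigr => b _.
    by rewrite /kill; case: ifP => _; rewrite ?mulr0 ?addr0 ?mulr1// mulrDr mulr1.
  have := @D_eq s u dA; rewrite mulrDr mulr1; lra.
split => //.
- by move=> u; rewrite addrAC subrr add0r; exact: Db.
(* Exact form of Kac's formula: [F s u * exp (- (s * f u))] is the mean of [1 + kill (D s)] after
   one step, so invariance of [pv] leaves only the term at [star], the one state where [kill]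
   changes [D s]. *)
- have kac : pv star * D s star = \sum_u pv u * ((1 + D s u) * (1 - expR (- (s * f u)))).
    have E1 u : pv u * ((1 + D s u) * (1 - expR (- (s * f u)))) = pv u * (1 + D s u) -
        pv u * \sum_b w u b * (1 + kill (D s) (nxt u b)).
      rewrite mulrBr mulr1 mulrBr; congr (_ - _ * _).
      rewrite [in LHS]rec mulrAC expRN mulfV ?gt_eqF ?expR_gt0// mul1r.
      by apply: eq_bigr => b _; rewrite /kill; case: ifP; rewrite ?addr0.
    under [RHS]eq_bigr do rewrite E1.
    rewrite sumrB (pv_inv (fun v => 1 + kill (D s) v)) -sumrB.
    rewrite (bigD1 star)//= big1 ?addr0 => [|u us]; first by rewrite /kill eqxx; ring.
    by rewrite /kill (negbTE us) subrr.
  rewrite addrAC subrr add0r kac mulr_sumr -sumrB mulr_suml.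
  apply: (le_trans (ler_norm_sum _ _ _)); apply: ler_sum => u _.
  rewrite (mulrCA s) -mulrBr normrM (ger0_norm (pv_ge0 u)) -mulrA ler_wpM2l//.
  have z0 : 0 <= s * f u by rewrite mulr_ge0.
  have h1 := @onem_expRN_le _ (s * f u).
  have h2 := @onem_expRN_ge _ _ z0.
  have h3 : 0 <= 1 - expR (- (s * f u)) by rewrite subr_ge0 -expR0 ler_expR oppr_le0.
  rewrite (_ : _ - _ = D s u * (1 - expR (- (s * f u))) +
      (1 - expR (- (s * f u)) - s * f u)); last by ring.
  apply: (le_trans (ler_normD _ _)).
  have h4 : 1 - expR (- (s * f u)) - s * f u <= 0 by rewrite subr_le0.
  rewrite normrM (ger0_norm h3) (ler0_norm h4).
  have hq : `|D s u| * (1 - expR (- (s * f u))) <= C * s * (s * f u) by exact: ler_pM.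
  have -> : (C * f u + f u ^+ 2) * s ^+ 2 = C * s * (s * f u) + (s * f u) ^+ 2 by ring.
  lra.
- by move=> u; apply: cvgD; [exact: cvg_cst|exact: D_cont].
Qed.

End ReturnTime.

(** * Existence and second-order expansion of the root *)

Section RootAsymptotics.
Context {R : realType}.

(** Since [exp (g N)] is the cube of [exp (g N / 3)], the bound [1 + z <= exp z] suffices. The
    constant [M] serves to trade powers of [N] against one factor [c ^+ N] in the error terms. *)
Lemma cube_mul_expr_bounded (c : R) : 0 < c -> c < 1 ->
  exists M : R, forall N, N%:R ^+ 3 * c ^+ N <= M.
Proof.
move=> c0 c1; pose g := - ln c.
have g0 : 0 < g by rewrite oppr_gt0 ln_lt0// c0 c1.
exists ((3 / g) ^+ 3) => N.
have cE : c ^+ N = expR (- (g * N%:R)).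
  by rewrite -mulNr opprK expRM_natr lnK// posrE.
rewrite cE expRN ler_pdivrMr ?expR_gt0//.
have -> : expR (g * N%:R) = expR (g * N%:R / 3) ^+ 3.
  by rewrite -expRM_natl; congr expR; field.
rewrite -exprMn lerXn2r ?nnegrE//; first by rewrite mulr_ge0 ?expR_ge0 ?divr_ge0 ?ltW.
have := @expR_ge1Dx _ (g * N%:R / 3) => h.
have h3 : 0 <= 3 / g by rewrite divr_ge0 ?ltW.
have : 3 / g * (g * N%:R / 3) <= 3 / g * expR (g * N%:R / 3).
  by rewrite ler_wpM2l//; lra.
rewrite (_ : 3 / g * (g * N%:R / 3) = N%:R)//.
by field; rewrite gt_eqF.
Qed.

Lemma geometric_inv_sum (k : R) N : k != 0 ->
  (\sum_(q < N) k ^- q.+1) * (1 - k) = k ^- N - 1.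
Proof.
move=> k0; elim: N => [|N ih]; first by rewrite big_ord0 mul0r expr0 invr1 subrr.
rewrite big_ord_recr/= mulrDl ih exprS.
by field; rewrite k0 expf_neq0.
Qed.

Variables (c sg d0 s0 B : R) (d : R -> R).
Hypothesis c_gt0 : 0 < c.
Hypothesis c_lt1 : c < 1.
Hypothesis sg_ge0 : 0 <= sg.
Hypothesis d0_gt0 : 0 < d0.
Hypothesis s0_gt0 : 0 < s0.
Hypothesis B_ge0 : 0 <= B.
Hypothesis d_lin : forall s : R, 0 <= s -> s <= s0 -> `|d s - s * d0| <= B * s ^+ 2.
Hypothesis d_cont : forall s : R, 0 <= s -> s <= s0 -> d t @[t --> s] --> d s.

Let geo s N := \sum_(q < N) (c * expR (s * sg)) ^- q.+1.

Let geo_ge s N : (0 < N)%N -> c ^- N * (1 - N%:R * (s * sg)) <= geo s N.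
Proof.
case: N => // N _; rewrite /geo big_ord_recr/=.
apply: (@le_trans _ _ ((c * expR (s * sg)) ^- N.+1)); last first.
  rewrite lerDr sumr_ge0// => i _.
  by rewrite invr_ge0 exprn_ge0// mulr_ge0 ?expR_ge0 ?ltW.
rewrite exprMn invfM ler_wpM2l ?invr_ge0 ?exprn_ge0 ?(ltW c_gt0)//.
by rewrite -expRM_natl -expRN; exact: expR_ge1Dx.
Qed.

(** Intermediate values between 0, where [d] vanishes, and [s1]. The factor 4 in [s1] pays for two
    losses of one half: [d s1 >= d0 * s1 / 2] and [geo s1 N >= c ^- N / 2]. *)
Let root_exists N s1 : (0 < N)%N -> 0 < s1 -> s1 <= s0 ->
  B * s1 <= d0 / 2 -> N%:R * (s1 * sg) <= 2^-1 -> d0 * s1 = 4 * c ^+ N ->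
  exists s : R, [/\ 0 < s, s <= s1 & d s * geo s N = 1].
Proof.
move=> N0 s10 s1s0 Bs1 Ns1 ds1.
have d00 : d 0 = 0.
  have := @d_lin 0 (lexx _) (ltW s0_gt0).
  by rewrite mul0r subr0 expr0n/= mulr0 normr_le0 => /eqP.
pose g s := d s * geo s N.
have cg : {within `[0, s1], continuous g}.
  apply: continuous_in_subspaceT => s /set_mem/=; rewrite in_itv/= => /andP[s_ge0 ss1].
  apply: cvgM; first by apply: d_cont => //; exact: le_trans ss1 s1s0.
  apply: (@cvg_big _ _ +%R 0 xpredT) => [|j _]; first exact: add_continuous.
  have ck : c * expR (t * sg) @[t --> s] --> c * expR (s * sg).
    apply: cvgM; first exact: cvg_cst.
    apply: (@cvg_comp _ _ _ (fun t => t * sg) expR); last exact: continuous_expR.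
    by apply: cvgM => //; exact: cvg_cst.
  have cj : (c * expR (t * sg)) ^+ j.+1 @[t --> s] --> (c * expR (s * sg)) ^+ j.+1.
    apply: (@cvg_comp _ _ _ (fun t => c * expR (t * sg)) (fun z => z ^+ j.+1)); first exact: ck.
    exact: exprn_continuous.
  by apply: (cvgV _ cj); rewrite expf_neq0// mulf_neq0 ?gt_eqF ?expR_gt0.
have g0 : g 0 = 0 by rewrite /g d00 mul0r.
have g1 : 1 <= g s1.
  have := @d_lin s1 (ltW s10) s1s0; rewrite ler_norml => /andP[dl _].
  have dge : d0 * s1 / 2 <= d s1 by move: dl; rewrite expr2; nra.
  have cN : 0 < c ^+ N by rewrite exprn_gt0.
  have geoge : c ^- N / 2 <= geo s1 N.
    apply: le_trans (@geo_ge s1 N N0); rewrite ler_wpM2l ?invr_ge0 ?(ltW cN)//; lra.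
  apply: (@le_trans _ _ (d0 * s1 / 2 * (c ^- N / 2))).
    by rewrite ds1 le_eqVlt; apply/orP; left; apply/eqP; field; rewrite gt_eqF.
  by apply: ler_pM => //; [rewrite ds1; lra|rewrite divr_ge0// invr_ge0 ltW].
have [|s] := @IVT _ g 0 s1 1 (ltW s10) cg.
  by rewrite g0 ge_min ler01/= le_max g1 orbT.
rewrite in_itv/= => /andP[s_ge0 ss1] gs.
exists s; split => //; rewrite lt_neqAle s_ge0 andbT; apply/eqP => s0E.
by move: gs; rewrite -s0E g0 => /esym/eqP; rewrite oner_eq0.
Qed.

Let a := (1 - c) / d0.

(** A bootstrap in two rounds: the equation first gives [s = a X + O(N X^2)] with [X = c ^+ N], and
    this value, put back into [exp (N s sg)], gives the next term. *)
Let root_estimate M : (forall N, N%:R ^+ 3 * c ^+ N <= M) ->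
  exists K : R, 0 <= K /\ forall (N : nat) (s : R), (0 < N)%N -> 0 < s -> s <= s0 ->
  B * s <= d0 / 2 -> N%:R * (s * sg) <= 2^-1 -> d0 * s <= 4 * c ^+ N ->
  d s * geo s N = 1 ->
  `|s - (a * c ^+ N + a ^+ 2 * sg * N%:R * c ^+ N ^+ 2)| <= K * c ^+ N ^+ 2.
Proof.
move=> hM; have [K1 K1E] : exists K1, K1 = 4 / d0 by eexists.
pose K2 := B * K1 ^+ 2 + 12 + 4 * sg * K1.
pose K3 := (K2 + 2 * K1 * sg) / d0.
have K10 : 0 < K1 by rewrite K1E divr_gt0.
have d0K1 : d0 * K1 = 4 by rewrite K1E; field; rewrite gt_eqF.
have K1ge0 := ltW K10.
have d0ge0 := ltW d0_gt0.
have K20 : 0 <= K2.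
  have : 0 <= B * K1 ^+ 2 by rewrite mulr_ge0 ?sqr_ge0.
  have : 0 <= 4 * sg * K1 by rewrite !mulr_ge0.
  rewrite /K2; lra.
have K30 : 0 <= K3 by rewrite /K3 divr_ge0// addr_ge0// !mulr_ge0.
have M0 : 0 <= M by apply: le_trans (hM 0); rewrite expr0n/= mul0r.
exists ((K2 + (2 * K1 ^+ 2 * sg ^+ 2 + sg * K3) * M) / d0); split.
  apply: divr_ge0; last exact: ltW.
  have : 0 <= 2 * K1 ^+ 2 * sg ^+ 2 by rewrite !mulr_ge0 ?sqr_ge0.
  have : 0 <= sg * K3 by rewrite mulr_ge0.
  by move=> h1 h2; rewrite addr_ge0// mulr_ge0// addr_ge0.
move=> N s N0 sp ss0 Bs Ns ds /eqP eqs.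
set X := c ^+ N.
have X0 : 0 < X by rewrite exprn_gt0.
pose E := expR (N%:R * (s * sg)); pose e1 := expR (s * sg).
have N1 : 1 <= N%:R :> R by rewrite ler1n.
have ssg0 : 0 <= s * sg by rewrite mulr_ge0// ltW.
have ssg : s * sg <= 2^-1.
  by apply: le_trans Ns; rewrite -[leLHS]mul1r ler_wpM2r.
have z0 : 0 <= N%:R * (s * sg) by rewrite mulr_ge0.
have E1 : 1 + N%:R * (s * sg) <= E by exact: expR_ge1Dx.
have E2 : E - 1 <= 2 * (N%:R * (s * sg)) by exact: expR_sub1_le2.
have E3 : E <= 1 + N%:R * (s * sg) + 2 * (N%:R * (s * sg)) ^+ 2 by exact: expR_sub1D_le.
have e11 : 1 <= e1 by have := @expR_ge1Dx _ (s * sg); rewrite /e1; lra.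
have e12 : e1 - 1 <= 2 * (s * sg) by exact: expR_sub1_le2.
have sX : s <= K1 * X.
  by rewrite K1E mulrAC ler_pdivlMr// mulrC.
have eq1 : d s * (1 - X * E) = X * E * (1 - c * e1).
  have k0 : c * e1 != 0 by rewrite mulf_neq0 ?gt_eqF ?expR_gt0.
  have kN : (c * e1) ^+ N = X * E by rewrite exprMn /X /E expRM_natl.
  have kN0 : (c * e1) ^+ N != 0 by rewrite expf_neq0.
  have := geometric_inv_sum _ N k0; rewrite -/(geo s N) => hg.
  have dE : d s * (c * e1) ^- N - d s = 1 - c * e1.
    have := congr1 (fun t => t * (1 - c * e1)) (eqP eqs).
    by rewrite /= mul1r -mulrA hg => <-; ring.
  by rewrite -dE -kN; field.
have := @d_lin s (ltW sp) ss0; rewrite ler_norml => /andP[dl du].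
have Bs2 : B * s ^+ 2 <= d0 / 2 * s by rewrite expr2 mulrA ler_wpM2r// ltW.
have s2 : s ^+ 2 <= K1 ^+ 2 * X ^+ 2 by rewrite -exprMn lerXn2r ?nnegrE ?mulr_ge0// ltW.
have Bs3 : B * s ^+ 2 <= B * K1 ^+ 2 * X ^+ 2 by rewrite -mulrA ler_wpM2l.
have ds0 : 0 <= d s by nra.
have dsX : d s <= 6 * X by nra.
have XE0 : 0 <= X * E by rewrite mulr_ge0// ?expR_ge0// ltW.
have XE2 : X * E <= 2 * X by rewrite mulrC ler_wpM2r ?(ltW X0)//; lra.
have T2 : d s * (X * E) <= 12 * X ^+ 2.
  apply: (le_trans (ler_pM ds0 XE0 dsX XE2)); rewrite expr2; lra.
have ce0 : 0 <= c * (e1 - 1) by rewrite mulr_ge0 ?subr_ge0// ltW.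
have ce1 : c * (e1 - 1) <= 2 * K1 * sg * X.
  apply: (@le_trans _ _ (1 * (2 * (s * sg)))).
    by rewrite ler_pM// ?subr_ge0// ltW.
  rewrite mul1r (_ : 2 * K1 * sg * X = 2 * (K1 * X * sg)); last by ring.
  by rewrite ler_wpM2l// ler_wpM2r.
have T3 : X * E * (c * (e1 - 1)) <= 4 * sg * K1 * X ^+ 2.
  apply: (le_trans (ler_pM XE0 ce0 XE2 ce1)); rewrite le_eqVlt; apply/orP; left; apply/eqP; ring.
(* Three errors of order [X ^+ 2] are collected: the nonlinearity of [d], the factor [1 - X * E],
   and the replacement of [c * e1] by [c]. The exponential [E] is kept, since it carries the term in
   [N]. *)
have S1 : `|s * d0 - X * (1 - c) * E| <= K2 * X ^+ 2.
  have -> : s * d0 - X * (1 - c) * E = (s * d0 - d s) + d s * (X * E) - X * E * (c * (e1 - 1)).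
    by have : d s = d s * (X * E) + X * E * (1 - c * e1); [lra|move=> {1}->; ring].
  have T20 : 0 <= d s * (X * E) by exact: mulr_ge0.
  have T30 : 0 <= X * E * (c * (e1 - 1)) by exact: mulr_ge0.
  by rewrite ler_norml /K2; apply/andP; split; lra.
have c01 : 0 <= 1 - c by rewrite subr_ge0 ltW.
have c00 := ltW c_gt0.
have Xc : X * (1 - c) <= X by nra.
have Xc0 : 0 <= X * (1 - c) by rewrite mulr_ge0// ltW.
have ssgX : s * sg <= K1 * sg * X by rewrite mulrAC ler_wpM2r.
have NssgX : N%:R * (s * sg) <= N%:R * (K1 * sg * X) by rewrite ler_wpM2l.
have S2 : `|s - a * X| <= K3 * (N%:R * X ^+ 2).
  have E10 : 0 <= E - 1 by lra.
  have h4 : X * (1 - c) * (E - 1) <= X * (2 * (N%:R * (K1 * sg * X))).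
    by apply: ler_pM => //; lra.
  have h5 : X ^+ 2 <= N%:R * X ^+ 2 by rewrite -[leLHS]mul1r ler_wpM2r ?sqr_ge0.
  have h6 : K2 * X ^+ 2 <= K2 * (N%:R * X ^+ 2) by rewrite ler_wpM2l.
  have h7 : 0 <= X * (1 - c) * (E - 1) by exact: mulr_ge0.
  rewrite -(ler_pM2r d0_gt0) -[X in `|_| * X](gtr0_norm d0_gt0) -normrM.
  have -> : (s - a * X) * d0 = (s * d0 - X * (1 - c) * E) + X * (1 - c) * (E - 1).
    by rewrite /a; field; rewrite gt_eqF.
  have -> : K3 * (N%:R * X ^+ 2) * d0 = K2 * (N%:R * X ^+ 2) + X * (2 * (N%:R * (K1 * sg * X))).
    by rewrite /K3; field; rewrite gt_eqF.
  by move: S1; rewrite !ler_norml => /andP[? ?]; apply/andP; split; lra.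
have NX : N%:R ^+ 2 * X <= M.
  by apply: le_trans (hM N); rewrite ler_wpM2r ?(ltW X0)// ler_weXn2l.
(* Second round. The remainder of [E] beyond first order, and the replacement of [s] by [a * X] in
   its linear term, both cost [N^2 X^3], which [NX] bounds by a multiple of [X^2]. *)
rewrite -(ler_pM2r d0_gt0) -[X in `|_| * X](gtr0_norm d0_gt0) -normrM.
have -> : (s - (a * X + a ^+ 2 * sg * N%:R * X ^+ 2)) * d0 =
  (s * d0 - X * (1 - c) * E) + X * (1 - c) * (E - 1 - N%:R * (s * sg)) +
   X * (1 - c) * (N%:R * sg * (s - a * X)).
  by rewrite /a; field; rewrite gt_eqF.
rewrite (_ : _ / d0 * X ^+ 2 * d0 = K2 * X ^+ 2 +
    (2 * K1 ^+ 2 * sg ^+ 2 * M * X ^+ 2 + sg * K3 * M * X ^+ 2)); last first.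
  by field; rewrite gt_eqF.
have Q1 : X * (1 - c) * (E - 1 - N%:R * (s * sg)) <= 2 * K1 ^+ 2 * sg ^+ 2 * M * X ^+ 2.
  have h1 : 0 <= E - 1 - N%:R * (s * sg) by lra.
  have h2 : E - 1 - N%:R * (s * sg) <= 2 * (N%:R * (K1 * sg * X)) ^+ 2.
    have : (N%:R * (s * sg)) ^+ 2 <= (N%:R * (K1 * sg * X)) ^+ 2.
      by rewrite lerXn2r ?nnegrE// (le_trans z0).
    lra.
  apply: (le_trans (ler_pM Xc0 h1 Xc h2)).
  rewrite (_ : X * _ = 2 * K1 ^+ 2 * sg ^+ 2 * (N%:R ^+ 2 * X) * X ^+ 2); last by ring.
  by rewrite ler_wpM2r ?sqr_ge0// ler_wpM2l// mulr_ge0 ?sqr_ge0// mulr_ge0 ?sqr_ge0.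
have Q10 : 0 <= X * (1 - c) * (E - 1 - N%:R * (s * sg)) by rewrite mulr_ge0//; lra.
have Q2 : `|X * (1 - c) * (N%:R * sg * (s - a * X))| <= sg * K3 * M * X ^+ 2.
  have Nsg : 0 <= N%:R * sg by rewrite mulr_ge0.
  rewrite normrM (ger0_norm Xc0) normrM (ger0_norm Nsg).
  apply: (@le_trans _ _ (X * (N%:R * sg * (K3 * (N%:R * X ^+ 2))))).
    by apply: ler_pM => //; rewrite ?mulr_ge0// ler_wpM2l.
  rewrite (_ : X * _ = sg * K3 * (N%:R ^+ 2 * X) * X ^+ 2); last by ring.
  by rewrite ler_wpM2r ?sqr_ge0// ler_wpM2l// mulr_ge0.
move: S1 Q2; rewrite !ler_norml => /andP[? ?] /andP[? ?].
by apply/andP; split; lra.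
Qed.

(* The equation for [r N] reads [d s * (1 - k ^+ N) = k ^+ N * (1 - k)] with
   [k = c * expR (s * sg)]; the quadratic term comes from [expR (N * s * sg)]. *)
Lemma root_asymptotics : exists (r : nat -> R) (K : R) (N0 : nat),
  0 <= K /\ forall N, (N0 <= N)%N ->
  [/\ 0 < r N, r N <= s0, r N <= K * c ^+ N,
      d (r N) * (\sum_(q < N) (c * expR (r N * sg)) ^- q.+1) = 1 &
      `|r N - (a * c ^+ N + a ^+ 2 * sg * N%:R * c ^+ N ^+ 2)| <= K * c ^+ N ^+ 2].
Proof.
have [M hM] := @cube_mul_expr_bounded c c_gt0 c_lt1.
have M0 : 0 <= M by apply: le_trans (hM 0); rewrite expr0n/= mul0r.
have [K [K0 hK]] := @root_estimate M hM.
have K10 : 0 < 4 / d0 by rewrite divr_gt0.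
(* As [N * (N * c ^+ N) <= M], the three summands in the last factor yield for [N >= L] the three
   smallness conditions of [root_exists] at [s1 = 4 / d0 * c ^+ N]. *)
pose L := 1 + M * (4 / d0) * (s0^-1 + 2 * B / d0 + 2 * sg).
have hL N : L <= N%:R -> [/\ (0 < N)%N, 4 / d0 * c ^+ N <= s0,
    B * (4 / d0 * c ^+ N) <= d0 / 2 & N%:R * (4 / d0 * c ^+ N * sg) <= 2^-1].
  move=> LN.
  have t1 : 0 <= M * (4 / d0) * s0^-1 by rewrite !mulr_ge0// ?invr_ge0 ltW.
  have t2 : 0 <= M * (4 / d0) * (2 * B / d0).
    by rewrite !mulr_ge0// ?invr_ge0 ?mulr_ge0// ltW.
  have t3 : 0 <= M * (4 / d0) * (2 * sg) by rewrite !mulr_ge0// ?invr_ge0 ltW.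
  have LE : L = 1 + M * (4 / d0) * s0^-1 + M * (4 / d0) * (2 * B / d0) + M * (4 / d0) * (2 * sg).
    by rewrite /L; ring.
  have N1 : 1 <= N%:R :> R by lra.
  have X0 : 0 < c ^+ N by rewrite exprn_gt0.
  have NX : N%:R * c ^+ N * N%:R <= M.
    apply: le_trans (hM N); rewrite mulrAC ler_wpM2r ?(ltW X0)// -expr2.
    by rewrite ler_weXn2l.
  have NX1 : c ^+ N * N%:R <= M.
    apply: le_trans NX; rewrite -[leLHS]mul1r -mulrA ler_wpM2r//.
    by rewrite mulr_ge0// ltW.
  have bound (t : R) : 0 <= t -> M * (4 / d0) * t <= N%:R -> 4 / d0 * t * (N%:R * c ^+ N) <= 1.
    move=> t0 tN; have NN : 0 < N%:R :> R by lra.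
    rewrite -(ler_pM2r NN) mul1r; apply: le_trans tN.
    rewrite (_ : _ * N%:R = N%:R * c ^+ N * N%:R * (4 / d0) * t); last by ring.
    by rewrite ler_wpM2r// ler_wpM2r// ltW.
  have bound1 (t : R) : 0 <= t -> M * (4 / d0) * t <= N%:R -> 4 / d0 * t * c ^+ N <= 1.
    move=> t0 tN; apply: le_trans (bound t t0 tN).
    have K1t : 0 <= 4 / d0 * t by rewrite mulr_ge0// ltW.
    rewrite (ler_wpM2l K1t)//.
    by rewrite -[X in X <= _]mul1r (ler_wpM2r (ltW X0)).
  have NN : (0 < N)%N by rewrite -(ltr0n R); lra.
  have b1 : 4 / d0 * s0^-1 * c ^+ N <= 1 by apply: bound1; [rewrite invr_ge0 ltW|lra].
  have b2 : 4 / d0 * (2 * B / d0) * c ^+ N <= 1.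
    by apply: bound1; [rewrite divr_ge0 ?mulr_ge0// ltW|lra].
  have b3 : 4 / d0 * (2 * sg) * (N%:R * c ^+ N) <= 1.
    by apply: bound; [rewrite mulr_ge0|lra].
  split=> //.
  - move: b1; rewrite mulrAC ler_pdivrMr// mul1r//.
  - move: b2; rewrite (_ : _ * c ^+ N = 2 * (B * (4 / d0 * c ^+ N)) / d0); last by ring.
    by rewrite ler_pdivrMr// mul1r; lra.
  - by move: b3; set q := 4 / d0; nra.
have [N0 hN0] : exists N0 : nat, L <= N0%:R.
  by exists (Num.truncn L).+1; exact/ltW/truncnS_gt.
(* Below [N0] the value 0 is a dummy, so that one sequence can be chosen for all [N]. *)
have ex N : exists s : R, (N0 <= N)%N -> [/\ 0 < s, s <= 4 / d0 * c ^+ N & d s * geo s N = 1].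
  have [N0N|?] := leqP N0 N; last by exists 0.
  have [N1 h1 h2 h3] : _ := hL N (le_trans hN0 (etrans (ler_nat R _ _) N0N)).
  have [||s [h4 h5 h6]] := @root_exists N _ N1 _ h1 h2 h3 _.
    by rewrite mulr_gt0// exprn_gt0.
    by field; rewrite gt_eqF.
  by exists s.
pose r N := sval (cid (ex N)).
exists r, (K + 4 / d0), N0; split; first by rewrite addr_ge0// ltW.
move=> N N0N; have := svalP (cid (ex N)) N0N; rewrite -/(r N) => -[h4 h5 h6].
have [N1 h1 h2 h3] : _ := hL N (le_trans hN0 (etrans (ler_nat R _ _) N0N)).
have X0 : 0 < c ^+ N by rewrite exprn_gt0.
split => //.
- exact: le_trans h1.
- by rewrite mulrDl (le_trans h5)// lerDr mulr_ge0// ltW.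
- apply: (le_trans (hK N (r N) N1 h4 (le_trans h5 h1) _ _ _ h6)).
  + exact: le_trans (ler_wpM2l B_ge0 h5) h2.
  + by apply: le_trans h3; rewrite ler_wpM2l// ler_wpM2r.
  + by rewrite mulrC -ler_pdivlMr// mulrAC.
  + by rewrite ler_wpM2r ?sqr_ge0// lerDl ltW.
Qed.

End RootAsymptotics.

(** * Cylinders and the Markov measure *)

Section Cylinders.
Context {S : finType} {s0 : S}.
Local Notation T := (Sigma s0).

Definition upd (w : nat -> S) (n : nat) (b : S) : nat -> S :=
  fun i => if i == n then b else w i.

(** Padding with [s0] makes a block a point of the sequence space, at which functions of [n] letters
    are evaluated. *)
Definition word n (u : {ffun 'I_n -> S}) : nat -> S :=
  fun i => if insub i is Some j then u j else s0.

Definition block n (w : nat -> S) : {ffun 'I_n -> S} := [ffun i : 'I_n => w i].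

Lemma word_block n w i : (i < n)%N -> word n (block n w) i = w i.
Proof. by move=> ni; rewrite /word insubT ffunE. Qed.

Lemma block_word n u : block n (word n u) = u.
Proof. by apply/ffunP => i; rewrite ffunE /word valK. Qed.

Lemma eq_block n w w' : block n w = block n w' <-> agree w w' n.
Proof.
split=> [/ffunP e i ni|e]; first by have := e (Ordinal ni); rewrite !ffunE.
by apply/ffunP => i; rewrite !ffunE e.
Qed.

Lemma agree_upd w n b : agree (upd w n b) w n.
Proof. by move=> i ni; rewrite /upd ltn_eqF. Qed.

Lemma agree_sym (y y' : nat -> S) n : agree y y' n -> agree y' y n.
Proof. by move=> h i ni; rewrite h. Qed.

Lemma agree_trans (y1 y2 y3 : nat -> S) n : agree y1 y2 n -> agree y2 y3 n -> agree y1 y3 n.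
Proof. by move=> h h' i ni; rewrite h// h'. Qed.

Lemma agree_le (y y' : nat -> S) m n : (m <= n)%N -> agree y y' n -> agree y y' m.
Proof. by move=> mn h i im; rewrite h// (leq_trans im). Qed.

Lemma agreeS (y y' : nat -> S) n : agree y y' n.+1 <-> agree y y' n /\ y n = y' n.
Proof.
split=> [h|[h e] i]; first by split; [exact: agree_le h|exact: h].
by rewrite ltnS leq_eqVlt => /predU1P[->//|]; exact: h.
Qed.

Lemma agree_shift (y y' : nat -> S) k n : agree y y' (k + n) ->
  agree (iter k (@sshift S) y) (iter k (@sshift S) y') n.
Proof.
elim: k y y' => [//|k ih] y y' h; rewrite !iterSr; apply: ih => i ik.
by rewrite /sshift h// addSn ltnS.
Qed.

Lemma iter_sshiftE k (y : nat -> S) i : iter k (@sshift S) y i = y (k + i)%N.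
Proof. by elim: k i => [//|k ih] i; rewrite iterS /sshift ih addnS. Qed.

Lemma measurable_cyl w n : measurable (cyl s0 w n : set T).
Proof. by apply: sub_gen_smallest; exists w, n. Qed.

Lemma bigcup_block n : \bigcup_(u : {ffun 'I_n -> S}) cyl s0 (word n u) n = setT.
Proof.
rewrite -subTset => y _; exists (block n y) => //= i ni.
by rewrite word_block.
Qed.

Lemma trivIset_block n : trivIset setT (fun u : {ffun 'I_n -> S} => cyl s0 (word n u) n).
Proof.
move=> u u' _ _ [y [/= h h']]; rewrite -(block_word n u) -(block_word n u').
by apply/eq_block; exact: agree_trans (agree_sym _ _ _ h) h'.
Qed.

(** Such a set is a union of [n]-cylinders, finitely many because the alphabet is finite. *)
Lemma measurable_depends (X : set T) n :
  (forall y y' : T, agree y y' n -> X y -> X y') -> measurable X.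
Proof.
move=> hX.
have -> : X = \bigcup_(u in [set u : {ffun 'I_n -> S} | X (word n u)]) cyl s0 (word n u) n.
  apply/seteqP; split => [y Xy|y [u /= Xu yu]].
    have a : agree y (word n (block n y)) n by move=> i ni; rewrite word_block.
    by exists (block n y) => //=; exact: hX Xy.
  by apply: hX Xu; exact: agree_sym.
apply: fin_bigcup_measurable; first exact: finite_finset.
by move=> u _; exact: measurable_cyl.
Qed.

Lemma measurable_fun_depends d (T' : measurableType d) (g : T -> T') n :
  (forall y y' : T, agree y y' n -> g y = g y') -> measurable_fun setT g.
Proof.
move=> hg _ Y mY; rewrite setTI; apply: (@measurable_depends _ n) => y y' a.
by rewrite /preimage/= (hg _ _ a).
Qed.

Context {R : realType} (P : S -> S -> R) (pi : S -> R) (mu : {measure set T -> \bar R}).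
Hypothesis pi_sum1 : \sum_a pi a = 1.
Hypothesis muP : markov_measure P pi mu.

Lemma integral_partition (I : finType) (F : I -> set T) (D : set T) (f : T -> R) :
  measurable D -> (forall i, measurable (F i)) -> trivIset setT F ->
  D `<=` \bigcup_i F i -> measurable_fun setT f -> (forall y, 0 <= f y) ->
  (\int[mu]_(y in D) (f y)%:E = \sum_i \int[mu]_(y in D `&` F i) (f y)%:E)%E.
Proof.
move=> mD mF tF DF mf f0.
have DE : D = \big[setU/set0]_(i <- index_enum I) (D `&` F i).
  rewrite -bigcup_seq; apply/seteqP; split => [y Dy|y [i _ []]//].
  by have [i _ Fiy] := DF y Dy; exists i => //=; rewrite mem_index_enum.
rewrite {1}DE ge0_integral_bigsetU//.
- by move=> i; exact: measurableI.
- exact: index_enum_uniq.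
- by apply: (@trivIset_setIl _ _ _ F (fun=> D)); apply: sub_trivIset tF.
- by apply/measurable_EFinP; apply: measurable_funTS.
- by move=> y _; rewrite lee_fin.
Qed.

Definition pr (X : set T) : R := fine (mu X).

(** [markov_measure] prescribes only cylinders of positive length, so the total mass is obtained by
    splitting along the first letter. *)
Lemma mu_setT : mu setT = 1%E.
Proof.
rewrite -[LHS]mul1e -integral_cst//.
rewrite (@integral_partition _ (fun a => cyl s0 (fun=> a) 1) setT (fun=> 1))//.
- under eq_bigr => a _.
    rewrite setTI integral_cst; last exact: measurable_cyl.
    rewrite mul1e muP big_ord0 mulr1; over.
  by rewrite sumEFin pi_sum1.
- by move=> a; exact: measurable_cyl.
- by move=> a a' _ _ [y [/= h h']]; rewrite -(h 0)// -(h' 0).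
- by move=> y _; exists (y 0) => //= -[].
Qed.

Lemma mu_le1 (X : set T) : measurable X -> (mu X <= 1)%E.
Proof. by move=> mX; rewrite -mu_setT le_measure ?inE. Qed.

Lemma mu_fin (X : set T) : measurable X -> mu X \is a fin_num.
Proof.
by move=> mX; rewrite ge0_fin_numE ?measure_ge0// (le_lt_trans (mu_le1 _ mX))// ltry.
Qed.

Lemma prE (X : set T) : measurable X -> mu X = (pr X)%:E.
Proof. by move=> mX; rewrite fineK// mu_fin. Qed.

Lemma pr_ge0 (X : set T) : 0 <= pr X. Proof. by rewrite fine_ge0// measure_ge0. Qed.

Lemma pr_le (X Y : set T) : measurable X -> measurable Y -> X `<=` Y -> pr X <= pr Y.
Proof. by move=> mX mY XY; rewrite -lee_fin -!prE// le_measure ?inE. Qed.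

Lemma pr_setT : pr setT = 1. Proof. by rewrite /pr mu_setT. Qed.

Lemma pr_partition (I : finType) (F : I -> set T) (D : set T) :
  measurable D -> (forall i, measurable (F i)) -> trivIset setT F ->
  D `<=` \bigcup_i F i -> pr D = \sum_i pr (D `&` F i).
Proof.
move=> mD mF tF DF; apply: EFin_inj; rewrite -sumEFin -prE//.
rewrite -[LHS]mul1e -integral_cst// (@integral_partition _ F D (fun=> 1))//.
apply: eq_bigr => i _; rewrite integral_cst ?mul1e ?prE//; exact: measurableI.
Qed.

Lemma pr_split (D : set T) w n : measurable D ->
  pr (D `&` cyl s0 w n) = \sum_b pr (D `&` cyl s0 (upd w n b) n.+1).
Proof.
move=> mD.
rewrite (@pr_partition _ (fun b => cyl s0 (upd w n b) n.+1)).
- apply: eq_bigr => b _; congr pr; apply/seteqP; split=> [y [[]]//|y [Dy yb]].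
  split=> //; split=> //; move/agreeS : yb => [yb _].
  by apply: agree_trans yb _; exact: agree_upd.
- exact: measurableI (measurable_cyl _ _).
- by move=> b; exact: measurable_cyl.
- by move=> b b' _ _ [y [/= /(_ n (ltnSn n)) h /(_ n (ltnSn n))]]; rewrite h /upd eqxx.
- move=> y [Dy yw]; exists (y n) => //=; apply/agreeS; rewrite {2}/upd eqxx; split=> //.
  by apply: agree_trans yw _; apply: agree_sym; exact: agree_upd.
Qed.

Lemma pr_cyl w n : pr (cyl s0 w n.+1) = pi (w 0) * \prod_(i < n) P (w i) (w i.+1).
Proof. by rewrite /pr muP. Qed.

Lemma pr_upd w n b : pr (cyl s0 (upd w n.+1 b) n.+2) = pr (cyl s0 w n.+1) * P (w n) b.
Proof.
have ul i : (i <= n)%N -> upd w n.+1 b i = w i by move=> ni; rewrite agree_upd.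
have ub : upd w n.+1 b n.+1 = b by rewrite /upd eqxx.
rewrite !pr_cyl big_ord_recr/= (ul 0)// (ul n)// ub mulrA; congr (_ * _ * _).
by apply: eq_bigr => i _; rewrite (ul i) ?(ul i.+1)// ltnW.
Qed.

Lemma pr_le_cyl (D : set T) n K : measurable D ->
  (forall w, pr (D `&` cyl s0 w n) <= K * pr (cyl s0 w n)) -> pr D <= K.
Proof.
move=> mD h.
have mb u : measurable (cyl s0 (word n u) n : set T) by exact: measurable_cyl.
rewrite (@pr_partition _ _ D mD mb (@trivIset_block n)); last by rewrite bigcup_block.
rewrite -[leRHS]mulr1 -pr_setT.
rewrite (@pr_partition _ _ setT _ mb (@trivIset_block n))//; last by rewrite bigcup_block.
by rewrite mulr_sumr; apply: ler_sum => u _; rewrite setTI; exact: h.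
Qed.

Lemma integral_word (f : T -> R) n : (forall y y' : T, agree y y' n -> f y = f y') ->
  (forall y, 0 <= f y) ->
  fine (\int[mu]_y (f y)%:E) = \sum_u pr (cyl s0 (word n u) n) * f (word n u).
Proof.
move=> hf f0; have mf : measurable_fun setT f by exact: measurable_fun_depends hf.
have mb u : measurable (cyl s0 (word n u) n : set T) by exact: measurable_cyl.
rewrite (@integral_partition _ _ setT f _ mb (@trivIset_block n))//; last by rewrite bigcup_block.
rewrite (eq_bigr (fun u => (pr (cyl s0 (word n u) n) * f (word n u))%:E)) ?sumEFin//.
move=> u _; rewrite setTI EFinM -prE// muleC -integral_cst//.
by apply: eq_integral => y /set_mem/= yu; rewrite (hf _ _ yu).
Qed.

End Cylinders.

(** * The chain of [n]-blocks *)

Section BlockChain.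
Context {S : finType} {s0 : S} {R : realType}.
Local Notation T := (Sigma s0).
Variables (P : S -> S -> R) (n : nat).
Hypothesis n_gt0 : (0 < n)%N.
Local Notation V := {ffun 'I_n -> S}.
Local Notation word := (word (s0 := s0)).

(** An edge of the de Bruijn graph of order [n]: the window slides by one letter. *)
Definition nxt (u : V) (b : S) : V := block n (sshift (upd (word n u) n b)).

Definition blk (j : nat) (y : nat -> S) : V := block n (iter j (@sshift S) y).

Lemma nxt_blk j y b : nxt (blk j y) b = blk j.+1 (upd y (j + n) b).
Proof.
apply/eq_block => i ni; rewrite /sshift iter_sshiftE /upd addSn -addnS eqn_add2l.
case: ifP => // /negbT ne; rewrite word_block ?iter_sshiftE//.
by rewrite ltn_neqAle ne.
Qed.

Definition lastl (u : V) : S := word n u n.-1.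

Lemma lastl_blk j y : lastl (blk j y) = y (j + n.-1)%N.
Proof. by rewrite /lastl word_block ?iter_sshiftE// prednK. Qed.

Lemma lastl_nxt u b : lastl (nxt u b) = b.
Proof. by rewrite /lastl word_block ?prednK// /sshift prednK// /upd eqxx. Qed.

Lemma nxt_lt u b i : (i.+1 < n)%N -> word n (nxt u b) i = word n u i.+1.
Proof.
by move=> ni; rewrite word_block /sshift /upd ?ltn_eqF// ltnW.
Qed.

Lemma wpath_cat {V' S' : finType} (nx : V' -> S' -> V') (w : V' -> S' -> R) u l1 l2 :
  wpath nx w u (l1 ++ l2) = wpath nx w u l1 && wpath nx w (foldl nx u l1) l2.
Proof. by elim: l1 u => //= b l1 ih u; rewrite ih andbA. Qed.

Let w (u : V) (b : S) : R := P (lastl u) b.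

Lemma wpath_path u l : path (fun a b => 0 < P a b) (lastl u) l ->
  wpath nxt w u l /\ lastl (foldl nxt u l) = last (lastl u) l.
Proof.
elim: l u => //= b l ih u /andP[Pb pl].
by have [] := ih (nxt u b); rewrite lastl_nxt// => -> ->; rewrite /w Pb.
Qed.

(** Irreducibility leads to a block ending with the first letter of [x]; the following letters of
    [x] are then appended one by one. *)
Lemma reach_block (x : nat -> S) : irreducible P -> SigmaP P x ->
  forall u, exists l, wpath nxt w u l /\ foldl nxt u l = block n x.
Proof.
move=> irr Px.
(* Here [k] counts the letters still to be appended: the last [n - k] letters of [u] already spell
   the beginning of [x]. *)
have follow k : (k < n)%N -> forall u, (forall i, (i <= n.-1 - k)%N -> word n u (k + i)%N = x i) ->
    exists l, wpath nxt w u l /\ foldl nxt u l = block n x.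
  elim: k => [|k ih] kn u hu.
    exists [::]; split=> //=; rewrite -[u](@block_word S s0); apply/eq_block => i ni.
    by rewrite -(hu i)// subn0 -ltnS prednK.
  have hl : lastl u = x (n.-1 - k.+1)%N.
    by rewrite /lastl -hu// subnKC// -ltnS prednK.
  have [l [wl el]] : exists l, wpath nxt w (nxt u (x (n.-1 - k)%N)) l /\
      foldl nxt (nxt u (x (n.-1 - k)%N)) l = block n x.
    apply: ih => [|i]; first exact: ltnW.
    rewrite leq_eqVlt => /predU1P[->|ik].
      rewrite subnKC ?[LHS]lastl_nxt//.
      by rewrite -ltnS prednK// ltnW.
    rewrite nxt_lt; last by move: ik; lia.
    by rewrite -hu ?addSn//; move: ik; lia.
  exists (x (n.-1 - k)%N :: l); split=> //=; rewrite wl andbT /w hl.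
  have -> : (n.-1 - k)%N = (n.-1 - k.+1).+1 by lia.
  exact: Px.
move=> u; have [l [pl el]] := irr (lastl u) (x 0).
have [wl hl] := wpath_path u l pl.
have nn : (n.-1 < n)%N by rewrite prednK.
have [i|l' [wl' el']] := follow n.-1 nn (foldl nxt u l).
  by rewrite subnn leqn0 => /eqP ->; rewrite addn0 -el -hl.
by exists (l ++ l'); rewrite wpath_cat wl wl' foldl_cat.
Qed.

Context (pi : S -> R) (mu : {measure set T -> \bar R}).
Hypothesis stat : forall b, \sum_a pi a * P a b = pi b.
Hypothesis muP : markov_measure P pi mu.
Local Notation pr := (pr mu).

(** A pair (block, next letter) and a pair (previous letter, block) describe the same word of
    [n + 1] letters. The bijection [h] matches them, and stationarity of [pi] sums out the previous
    letter. *)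
Lemma block_stationary (G : V -> R) :
  \sum_u pr (cyl s0 (word n u) n) * \sum_b w u b * G (nxt u b) =
  \sum_u pr (cyl s0 (word n u) n) * G u.
Proof.
pose cw (a : S) (y : nat -> S) i := if i is i'.+1 then y i' else a.
have consE y : pr (cyl s0 y n) = \sum_a pr (cyl s0 (cw a y) n.+1).
  case: n n_gt0 => // m _; rewrite (pr_cyl _ _ _ muP) -stat mulr_suml.
  by apply: eq_bigr => a _; rewrite (pr_cyl _ _ _ muP) big_ord_recl/= mulrA.
under [RHS]eq_bigr => u _ do rewrite consE mulr_suml.
under [LHS]eq_bigr => u _ do rewrite mulr_sumr.
pose h (q : V * S) := (word n q.1 0, nxt q.1 q.2).
pose g (q : S * V) := (block n (cw q.1 (word n q.2)), lastl q.2).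
have hg : cancel h g.
  move=> [u b]; rewrite /g /h /= lastl_nxt; congr (_, _).
  rewrite -[RHS](@block_word S s0); apply/eq_block => -[//|i] ni /=.
  by rewrite nxt_lt.
have gh : cancel g h.
  move=> [a v]; rewrite /g /h /= word_block//; congr (_, _).
  rewrite -[RHS](@block_word S s0); apply/eq_block => i ni; rewrite /sshift /upd.
  case: eqP => [e|ne]; first by rewrite /lastl (_ : n.-1 = i)// -e.
  by rewrite word_block//; lia.
rewrite [RHS]exchange_big [RHS]pair_bigA/= (reindex h)/=; last by exists g => q _; [exact: hg|exact: gh].
rewrite pair_bigA/=; apply: eq_bigr => -[u b] _ /=; rewrite mulrA; congr (_ * _).
have -> : pr (cyl s0 (cw (word n u 0) (word n (nxt u b))) n.+1) =
    pr (cyl s0 (upd (word n u) n b) n.+1).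
  congr pr; apply/seteqP; split=> y yw i ni; rewrite yw//; case: i ni => [|i] ni /=.
  - by rewrite /upd ltn_eqF.
  - by rewrite word_block.
  - by rewrite /upd ltn_eqF.
  - by rewrite word_block.
by rewrite -[n in upd _ n](prednK n_gt0) -[n in _ n.+1](prednK n_gt0) (pr_upd _ _ _ muP) /w /lastl prednK.
Qed.

End BlockChain.

(** Meant for overlaps: the lengths congruent to the longest one modulo [p] get indexed by their
    quotient. In the induction, each further stretch of [p] indices contributes its endpoint
    only. *)
Lemma sum_dvdn_sub {V : nmodType} (G : nat -> V) p m : (0 < p)%N ->
  \sum_(i < m.+1) (if (p %| m - i)%N then G i else 0) =
  \sum_(q < (m %/ p).+1) G (m %% p + q * p)%N.
Proof.
move=> p_gt0.
have tail a b : (a <= b)%N -> (b < a + p)%N ->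
    \sum_(a <= i < b.+1) (if (p %| b - i)%N then G i else 0) = G b.
  move=> ab bap; rewrite big_nat_recr//= subnn dvdn0 big_nat_cond big1 ?add0r// => i.
  rewrite andbT => /andP[ai ib]; rewrite gtnNdvd ?subn_gt0//.
  by move: ai ib bap; lia.
have main r q : (r < p)%N ->
    \sum_(0 <= i < (r + q * p).+1) (if (p %| r + q * p - i)%N then G i else 0) =
    \sum_(k < q.+1) G (r + k * p)%N.
  move=> rp; elim: q => [|q ih]; first by rewrite mul0n addn0 big_ord1 mul0n addn0 tail.
  rewrite big_ord_recr/= -ih.
  have le : (r + q * p <= r + q.+1 * p)%N by rewrite leq_add2l leq_mul2r leqnSn orbT.
  rewrite (@big_cat_nat _ _ _ (r + q * p).+1)//= ?ltnS// (tail (r + q * p).+1); last 2 first.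
  - by rewrite mulSn; lia.
  - by rewrite mulSn; lia.
  congr (_ + _); apply: eq_big_nat => i /andP[_ ir].
  by rewrite mulSn addnCA -addnBA// dvdn_addr.
have := main (m %% p)%N (m %/ p)%N (ltn_pmod m p_gt0).
by rewrite addnC -divn_eq big_mkord.
Qed.

(** * The gambling martingale *)

Section Martingale.
Context {S : finType} {s0 : S} {R : realType}.
Local Notation T := (Sigma s0).
Variables (P : S -> S -> R) (x : nat -> S) (n p : nat) (phi : T -> R).
Local Notation word := (word (s0 := s0)).
Local Notation nxt := (nxt (s0 := s0) n).
Local Notation lastl := (lastl (s0 := s0) n).
Local Notation blk := (blk n).
Local Notation it k y := (iter k (@sshift S) y).
Hypothesis p_gt0 : (0 < p)%N.
Hypothesis p_le_n : (p <= n)%N.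
Hypothesis x_per : it p x = x.
Hypothesis x_min : forall q, (0 < q)%N -> (q < p)%N -> it q x <> x.
Hypothesis Px : SigmaP P x.
Hypothesis phi_dep : forall y y' : T, agree y y' n -> phi y = phi y'.

Let n_gt0 : (0 < n)%N. Proof. exact: leq_trans p_le_n. Qed.

Lemma per_mod i : x i = x (i %% p)%N.
Proof.
have xD k : x (k + p)%N = x k by rewrite -[in RHS]x_per iter_sshiftE addnC.
rewrite {1}(divn_eq i p); elim: (i %/ p)%N => [//|q ih].
by rewrite mulSn -addnA addnC xD.
Qed.

Lemma per_mul q i : x (i + q * p)%N = x i.
Proof. by rewrite per_mod addnC modnMDl -per_mod. Qed.

Lemma it_mul q : it (q * p) x = x.
Proof. by apply/funext => i; rewrite iter_sshiftE addnC per_mul. Qed.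

(** Agreement over one period extends to all indices by periodicity, so the residue of [r] modulo
    [p] is itself a period of [x], and primality forces it to be 0. *)
Lemma agree_self_dvd r : agree (it r x) x p -> (p %| r)%N.
Proof.
move=> h; apply/eqP; apply: contrapT => /eqP; rewrite -lt0n => r0.
apply: (x_min _ r0); first by rewrite ltn_mod.
apply/funext => i; rewrite iter_sshiftE per_mod modnDml -modnDmr -per_mod.
by rewrite -iter_sshiftE h ?ltn_mod// -per_mod.
Qed.

(** The letters read since [j - m0] are those of [x], so a shorter overlap is a match of [x] with a
    shift of itself over at least [n >= p] letters. *)
Lemma overlap_dvd y j m m0 : agree (it (j - m0) y) x (m0 + n) ->
  (m <= m0)%N -> (m0 <= j)%N ->
  agree (it (j - m) y) x (m + n) <-> (p %| m0 - m)%N.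
Proof.
move=> h mm0 m0j.
have {}h : agree (it (j - m) y) (it (m0 - m) x) (m + n).
  move=> i im; rewrite !iter_sshiftE -h; last by move: im; lia.
  by rewrite iter_sshiftE; congr y; lia.
split=> [h'|/dvdnP[q qE]]; last by move: h; rewrite qE it_mul.
apply: agree_self_dvd; apply: agree_trans (agree_le _ _ _ _ _ h').
  by apply: agree_sym; apply: agree_le h; exact: (leq_trans p_le_n (leq_addl _ _)).
exact: (leq_trans p_le_n (leq_addl _ _)).
Qed.

Variables (s : R) (F : {ffun 'I_n -> S} -> R).
Local Notation star := (block n x).
Hypothesis F_rec : forall u, F u = expR (s * phi (word n u)) *
  \sum_b P (lastl u) b * (if nxt u b == star then 1 else F (nxt u b)).

(** The inverse of the fair odds: a bet on the next letter of [x] is multiplied by [(gain i)^-1] if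
    it wins and lost otherwise, which preserves its expectation weighted by [exp (s * phi)]. *)
Definition gain i := expR (s * phi (it i x)) * P (x (i + n.-1)%N) (x (i + n)%N).

Lemma gain_gt0 i : 0 < gain i.
Proof.
rewrite mulr_gt0 ?expR_gt0//; have := Px (i + n.-1)%N.
by rewrite -addnS prednK.
Qed.

Definition overlap_weight m := \prod_(i < m) (gain i)^-1.
Local Notation W := overlap_weight.

Lemma W_gt0 m : 0 < W m.
Proof. by apply: prodr_gt0 => i _; rewrite invr_gt0 gain_gt0. Qed.

Definition cycle_gain := \prod_(i < p) gain i.
Local Notation kap := cycle_gain.

Lemma gain_per i : gain (i + p)%N = gain i.
Proof.
have xp k : x (k + p)%N = x k by rewrite -[p]mul1n per_mul.
by rewrite /gain iterD x_per addnAC xp addnAC xp.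
Qed.

Lemma WDp m : W (m + p)%N = W m * kap^-1.
Proof.
elim: m => [|m ih].
  rewrite /W big_ord0 mul1r /kap -(big_morph _ (@invfM R) (@invr1 R)).
  by rewrite add0n.
by rewrite addSn /W !big_ord_recr/= -/(W _) ih gain_per mulrAC.
Qed.

Lemma WDmul r q : W (r + q * p)%N = W r * kap ^- q.
Proof.
elim: q => [|q ih]; first by rewrite addn0 expr0 invr1 mulr1.
by rewrite mulSn addnCA addnC WDp ih exprS invfM [_^-1 * _]mulrC mulrA.
Qed.

Definition overlap y j := \sum_(m < j.+1)
  (if `[< agree (it (j - m) y) x (m + n) >] then W m else 0).

Lemma overlap_ge0 y j : 0 <= overlap y j.
Proof. by apply: sumr_ge0 => m _; case: ifP => // _; exact/ltW/W_gt0. Qed.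

Let d := F star - 1.

(* Each overlap of the end of [y] with a prefix of [x] is a running bet on the
   continuation along [x], worth [W m] after [m] fair steps; the stake [d] is what
   [F] gains when the block returns to [star]. *)
Definition mart y j := F (blk j y) - d * overlap y j.

(** The recursion of [F] counts an arrival at [star] as 1 instead of [F star]; the bet opened at
    that moment, the term [m = 0], has weight 1 and its stake [d] makes up the difference. Older
    bets pass from [m] to [m + 1] at fair odds. *)
Lemma mart_step y j :
  expR (s * phi (it j y)) * \sum_b P (y (j + n.-1)%N) b * mart (upd y (j + n)%N b) j.+1
  = mart y j.
Proof.
have E1 b : mart (upd y (j + n)%N b) j.+1 =
    (if nxt (blk j y) b == star then 1 else F (nxt (blk j y) b)) -
    d * \sum_(m < j.+1) (if `[< agree (it (j - m) y) x (m + n) >] then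
        (if b == x (m + n)%N then W m.+1 else 0) else 0).
  rewrite /mart -(nxt_blk (s0 := s0)) /overlap big_ord_recl/= mulrDr opprD addrA.
  congr (_ - d * _).
    rewrite /W big_ord0 (_ : `[< _ >] = (nxt (blk j y) b == star)).
      by case: eqP => [->|_]; rewrite ?mulr1 ?mulr0 ?subr0// /d; ring.
    apply/asboolP/eqP => [h|]; first by rewrite (nxt_blk (s0 := s0)); apply/eq_block.
    by rewrite (nxt_blk (s0 := s0)) => /eq_block.
  apply: eq_bigr => m _; rewrite /bump/= add1n subSS addSn.
  have -> : `[< agree (it (j - m) (upd y (j + n) b)) x (m + n).+1 >] =
      `[< agree (it (j - m) y) x (m + n) >] && (b == x (m + n)%N).
    have mj : (m <= j)%N by rewrite -ltnS.
    have a : agree (it (j - m) (upd y (j + n) b)) (it (j - m) y) (m + n).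
      by apply: agree_shift; rewrite addnA subnK//; exact: agree_upd.
    have e : it (j - m) (upd y (j + n) b) (m + n)%N = b.
      by rewrite iter_sshiftE addnA subnK// /upd eqxx.
    apply/asboolP/andP => [/agreeS[h1 h2]|[/asboolP h1 /eqP h2]].
      split; last by rewrite -h2 e.
      by apply/asboolP; apply: agree_trans h1; exact: agree_sym.
    by apply/agreeS; rewrite e; split=> //; exact: agree_trans a h1.
  by case: (`[< _ >]); case: (_ == _).
under eq_bigr => b _ do rewrite E1 mulrBr.
rewrite sumrB mulrBr; congr (_ - _).
  rewrite F_rec (lastl_blk (s0 := s0))//; congr (expR (s * _) * _); apply: phi_dep => i ni.
  by rewrite word_block.
rewrite (eq_bigr (fun b => d * \sum_(m < j.+1) (if `[< agree (it (j - m) y) x (m + n) >] then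
     (if b == x (m + n)%N then P (y (j + n.-1)%N) b * W m.+1 else 0) else 0))); last first.
  move=> b _; rewrite mulrCA; congr (_ * _); rewrite mulr_sumr; apply: eq_bigr => m _.
  case: ifP => _; last by rewrite mulr0.
  by case: ifP => _; rewrite ?mulr0.
rewrite -mulr_sumr mulrCA; congr (_ * _); rewrite exchange_big mulr_sumr.
apply: eq_bigr => m _; case: asboolP => [h|_]; last by rewrite big1 ?mulr0.
rewrite -big_mkcond big_pred1_eq /W big_ord_recr/= -/(W m).
have mj : (m <= j)%N by rewrite -ltnS.
have -> : y (j + n.-1)%N = x (m + n.-1)%N.
  rewrite -h; last by rewrite ltn_add2l prednK.
  by rewrite iter_sshiftE addnA subnK.
have -> : phi (it j y) = phi (it m x).
  apply: phi_dep; rewrite -{1}(subnK mj) addnC iterD.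
  exact: agree_shift.
by rewrite mulrA -/(gain m) (mulrC (W m)) mulrA mulfV ?mul1r// gt_eqF// gain_gt0.
Qed.

(** The longest overlap determines all others by [overlap_dvd], and [WDmul] makes their weights
    geometric. *)
Lemma overlap_max y j m0 : (m0 <= j)%N -> agree (it (j - m0) y) x (m0 + n) ->
  (forall m, (m0 < m)%N -> (m <= j)%N -> ~ agree (it (j - m) y) x (m + n)) ->
  overlap y j = W (m0 %% p)%N * \sum_(q < (m0 %/ p).+1) kap ^- q.
Proof.
move=> m0j h hmax; rewrite mulr_sumr.
under [RHS]eq_bigr do rewrite -WDmul.
rewrite -sum_dvdn_sub// /overlap.
rewrite -(big_mkord xpredT (fun m => if `[< agree (it (j - m) y) x (m + n) >] then W m else 0)).
rewrite -(big_mkord xpredT (fun i => if (p %| m0 - i)%N then W i else 0)).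
rewrite (@big_cat_nat _ _ _ m0.+1)//= ?ltnS//.
rewrite [X in _ + X]big_nat_cond [X in _ + X]big1 ?addr0 => [|m]; last first.
  by rewrite andbT => /andP[m0m mj]; rewrite asboolF//; exact: hmax.
apply: eq_big_nat => m /andP[_ mm0]; congr (if _ then _ else _).
by apply/asboolP/idP => /(overlap_dvd _ _ _ _ h mm0 m0j).
Qed.

(* [L + n] is the length of the word whose first occurrence ends the process. *)
Variable N : nat.
Hypothesis N_gt0 : (0 < N)%N.
Local Notation L := (N * p)%N.
Hypothesis root : d * (\sum_(q < N) kap ^- q.+1) = 1.

(** At step [j] the letters of index below [j + n] are known, so an occurrence starting at [i] is
    complete exactly when [i + L <= j]. *)
Definition alive (y : nat -> S) j := forall i, (i + L <= j)%N -> ~ agree (it i y) x (L + n).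

(** At the first completion the longest overlap is exactly [L], a longer one containing an earlier
    occurrence. The overlap sum is then [1 + 1/d] by [root], and the current block is [star], so the
    value is [F star - d - 1 = 0]. *)
Lemma mart_dead y j b : alive y j -> ~ alive (upd y (j + n) b) j.+1 ->
  mart (upd y (j + n)%N b) j.+1 = 0.
Proof.
set y' := upd _ _ _ => al /existsNP[i /not_implyP[iL /contrapT h]].
have al' k : (k + L <= j)%N -> ~ agree (it k y') x (L + n).
  move=> kL h'; apply: (al k kL); apply: agree_trans h'; apply: agree_sym.
  by apply: agree_shift; rewrite addnA; apply: agree_le (agree_upd _ _ _); rewrite leq_add2r.
have {iL}ij : (j.+1 - L)%N = i /\ (L <= j.+1)%N.
  move: iL; rewrite leq_eqVlt => /predU1P[<-|]; first by rewrite addnK leq_addl.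
  by rewrite ltnS => /al'.
rewrite -(proj1 ij) in h; have Lj := proj2 ij.
rewrite /mart (overlap_max _ _ _ Lj h); last first.
  move=> m Lm mj h'; apply: (al' (j.+1 - m)%N); first by move: Lm mj; lia.
  by apply: agree_le h'; rewrite leq_add2r ltnW.
rewrite modnMl mulnK// /W big_ord0 mul1r big_ord_recl expr0 invr1.
have -> : blk j.+1 y' = star.
  apply/eq_block; have := @agree_shift _ _ _ L n h.
  by rewrite -iterD subnKC// it_mul.
by rewrite mulrDr mulr1 root /d; ring.
Qed.

Lemma d_gt0 : 0 < d.
Proof.
have kap0 : 0 < kap by apply: prodr_gt0 => i _; exact: gain_gt0.
have S0 : 0 < \sum_(q < N) kap ^- q.+1.
  case: N N_gt0 => // k _; rewrite big_ord_recl ltr_pwDl ?invr_gt0 ?exprn_gt0//.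
  by apply: sumr_ge0 => i _; rewrite invr_ge0 exprn_ge0// ltW.
by rewrite -(pmulr_lgt0 _ S0) root.
Qed.

Lemma mart_le y j : mart y j <= F (blk j y).
Proof. by rewrite gerBl mulr_ge0 ?overlap_ge0// ltW// d_gt0. Qed.

Hypothesis s_ge0 : 0 <= s.
Hypothesis phi_ge0 : forall y, 0 <= phi y.
Hypothesis P_le1 : forall a b, P a b <= 1.

(** The product keeps the gains from [r] to [p - 1]. Since [r < p], the last one is always present,
    and its transition leads into the final letter of the period, where reducedness acts; the other
    probabilities are bounded by 1. *)
Lemma W_kap_le r : (r < p)%N ->
  W r * kap <= expR (s * \sum_(i < p) phi (it i x)) * P (x (p.-1 + n.-1)%N) (x (p.-1 + n)%N).
Proof.
move=> rp.
have P0 i : 0 <= P (x (i + n.-1)%N) (x (i + n)%N).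
  by have := Px (i + n.-1)%N; rewrite -addnS prednK// => /ltW.
have -> : W r * kap = \prod_(r <= i < p) gain i.
  rewrite /kap -(big_mkord xpredT gain) (@big_cat_nat _ _ _ r)//=; last exact: ltnW.
  rewrite [\prod_(0 <= i < r) _]big_mkord mulrA /W -big_split/= [X in X * _]big1 ?mul1r// => i _.
  by rewrite mulVf// gt_eqF// gain_gt0.
rewrite (@le_trans _ _ (\prod_(r <= i < p) expR (s * phi (it i x)) *
    \prod_(r <= i < p) P (x (i + n.-1)%N) (x (i + n)%N)))//; first by rewrite -big_split.
apply: ler_pM.
- by apply: prodr_ge0 => i _; exact: expR_ge0.
- by apply: prodr_ge0 => i _.
- rewrite -expR_sum ler_expR -mulr_sumr ler_wpM2l// -(big_mkord xpredT (fun i => phi (it i x))).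
  by rewrite [leRHS](@big_cat_nat _ _ _ r)//= ?(ltnW rp)// lerDr; apply: sumr_ge0.
- rewrite -[in X in X <= _](prednK p_gt0) big_nat_recr/=; last by rewrite -ltnS prednK.
  rewrite -[leRHS]mul1r ler_wpM2r// -[leRHS](@big1 _ 1 *%R _ (index_iota r p.-1) xpredT (fun=> 1))//.
  by apply: ler_prod => i _; rewrite P0 P_le1.
Qed.

(** While alive, the longest overlap is below [L], so its geometric sum has at most [N] terms. By
    [root] the full sum of [N] terms times [d] equals [kap], and [W_kap_le] concludes. *)
Lemma mart_ge y j : alive y j -> F (blk j y) -
    expR (s * \sum_(i < p) phi (it i x)) * P (x (p.-1 + n.-1)%N) (x (p.-1 + n)%N) <= mart y j.
Proof.
move=> al; rewrite /mart lerD2l lerN2.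
have kap0 : 0 < kap by apply: prodr_gt0 => i _; exact: gain_gt0.
have [[m [mj hm]]|no] := pselect (exists m, (m <= j)%N /\ agree (it (j - m) y) x (m + n)); last first.
  rewrite /overlap big1 ?mulr0 => [|m _]; last first.
    by rewrite asboolF// => h; apply: no; exists m; split => //; rewrite -ltnS.
  by rewrite mulr_ge0 ?expR_ge0//; have := Px (p.-1 + n.-1)%N; rewrite -addnS prednK// => /ltW.
have exP : exists m, (m <= j)%N && `[< agree (it (j - m) y) x (m + n) >].
  by exists m; rewrite mj; apply/asboolP.
have ub i : (i <= j)%N && `[< agree (it (j - i) y) x (i + n) >] -> (i <= j)%N by case/andP.
case: (ex_maxnP exP ub) => m0 /andP[m0j /asboolP h] hmax.
rewrite (overlap_max _ _ _ m0j h); last first.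
  move=> k m0k kj hk; have := hmax k; rewrite kj/= leqNgt m0k.
  by move=> /(_ (introT (asboolP _) hk)).
have m0L : (m0 < L)%N.
  rewrite ltnNge; apply/negP => Lm; apply: (al (j - m0)%N); first by move: Lm m0j; lia.
  by apply: agree_le h; rewrite leq_add2r.
have qN : (m0 %/ p < N)%N by rewrite ltn_divLR.
apply: le_trans (W_kap_le (m0 %% p) (ltn_pmod _ p_gt0)).
rewrite mulrCA ler_wpM2l ?(ltW (W_gt0 _))//.
have kapE : kap = d * \sum_(q < N) kap ^- q.
  rewrite -[LHS]mul1r -root -mulrA mulr_suml; congr (_ * _); apply: eq_bigr => q _.
  by rewrite exprSr invfM -mulrA mulVf ?gt_eqF// mulr1.
rewrite [leRHS]kapE ler_wpM2l ?(ltW d_gt0)//.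
rewrite -!(big_mkord xpredT (fun q => kap ^- q)) [leRHS](@big_cat_nat _ _ _ (m0 %/ p).+1)//=.
by rewrite lerDl; apply: sumr_ge0 => i _; rewrite invr_ge0 exprn_ge0// ltW.
Qed.

End Martingale.

(** * Optional stopping for the symbolic survival set *)

Section SurvivalSet.
Context {S : finType} {s0 : S} {R : realType}.
Local Notation T := (Sigma s0).
Variables (P : S -> S -> R) (pi : S -> R) (mu : {measure set T -> \bar R}).
Variables (x : nat -> S) (n p N : nat) (phi : T -> R) (c M : R).
Local Notation it k y := (iter k (@sshift S) y).
Local Notation birk := (birk (@sshift S) phi).
Local Notation pr := (pr mu).
Local Notation alive := (alive x n p N).
Local Notation L := (N * p)%N.
Hypothesis n_gt0 : (0 < n)%N.
Hypothesis L_gt0 : (0 < L)%N.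
Hypothesis pi_gt0 : forall a, 0 < pi a.
Hypothesis pi_sum1 : \sum_a pi a = 1.
Hypothesis muP : markov_measure P pi mu.
Hypothesis Px : SigmaP P x.
Hypothesis phi_dep : forall y y' : T, agree y y' n -> phi y = phi y'.
Hypothesis c_gt0 : 0 < c.
Hypothesis phi_ge : forall y, c <= phi y.
Hypothesis phi_le : forall y, phi y <= M.

Lemma birkS j y : birk j.+1 y = birk j y + phi (it j y).
Proof. by rewrite /birk big_ord_recr. Qed.

Lemma birk_ge j y : c * j%:R <= birk j y.
Proof.
elim: j => [|j ih]; first by rewrite mulr0 /birk big_ord0.
by rewrite birkS -natr1 mulrDr mulr1 lerD.
Qed.

Lemma birk_lt j k y : (j < k)%N -> birk j y < birk k y.
Proof.
elim: k => // k ih; rewrite ltnS leq_eqVlt birkS => /predU1P[->|/ih h].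
  by rewrite ltrDl (lt_le_trans c_gt0).
by rewrite (lt_le_trans h)// lerDl (le_trans (ltW c_gt0)).
Qed.

Lemma birk_lt_idx j k y : birk j y < birk k y -> (j < k)%N.
Proof.
rewrite ltnNge => h; apply/negP; rewrite leq_eqVlt => /predU1P[e|/(birk_lt _ _ y)].
  by rewrite e ltxx in h.
by move=> /(lt_trans h); rewrite ltxx.
Qed.

Lemma birk_dep j y y' : agree y y' (j + n) -> birk j y = birk j y'.
Proof.
move=> h; apply: eq_bigr => i _; apply: phi_dep; apply: agree_shift.
by apply: agree_le h; rewrite leq_add2r ltnW.
Qed.

Lemma birk_addn_le k j y : birk (j + k) y <= birk j y + M * k%:R.
Proof.
elim: k => [|k ih]; first by rewrite addn0 mulr0 addr0.
by rewrite addnS birkS -natr1 mulrDr mulr1 addrA lerD.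
Qed.

Lemma alive_dep j y y' : agree y y' (j + n) -> alive y j -> alive y' j.
Proof.
move=> h al i iL h'; apply: (al i iL); apply: agree_trans h'.
by apply: agree_shift; rewrite addnA; apply: agree_le h; rewrite leq_add2r.
Qed.

Lemma alive_le j k y : (j <= k)%N -> alive y k -> alive y j.
Proof. by move=> jk al i iL; apply: al; exact: leq_trans jk. Qed.

(** Being alive at the stopping step, the first index whose Birkhoff sum exceeds [t]: its
    predecessor [j] has sum at most [t], whence [j.+1]. *)
Definition survive t : set T := [set y | forall j, birk j y <= t -> alive y j.+1].

Let fuel_exists t : exists k : nat, t < c * k%:R.
Proof.
exists (Num.truncn (t / c)).+1.
by rewrite mulrC -ltr_pdivrMr//; exact: truncnS_gt.
Qed.

Lemma measurable_survive t : measurable (survive t).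
Proof.
have [k hk] := fuel_exists t.
apply: (@measurable_depends _ _ _ (k.+1 + n)) => y y' h sy j jt.
have jk : (j < k)%N.
  rewrite ltnNge; apply/negP => kj; have := birk_ge j y'.
  have : c * k%:R <= c * j%:R by rewrite ler_wpM2l ?ler_nat// ltW.
  lra.
have hj : agree y y' (j.+1 + n) by apply: agree_le h; rewrite leq_add2r ltnW.
apply: (alive_dep _ _ _ hj); apply: sy; rewrite (birk_dep j _ y')//.
by apply: agree_le hj; rewrite leq_add2r.
Qed.

Variables (s : R) (g : (nat -> S) -> nat -> R) (gmin gmax : R).
Hypothesis s_ge0 : 0 <= s.
Hypothesis g_step : forall y j, expR (s * phi (it j y)) *
  \sum_b P (y (j + n.-1)%N) b * g (upd y (j + n)%N b) j.+1 = g y j.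
Hypothesis g_dead : forall y j b, alive y j -> ~ alive (upd y (j + n)%N b) j.+1 ->
  g (upd y (j + n)%N b) j.+1 = 0.
Hypothesis g_ge : forall y j, alive y j -> gmin <= g y j.
Hypothesis g_le : forall y j, g y j <= gmax.
Hypothesis gmin_gt0 : 0 < gmin.

Let prX := pr_ge0 mu.
Let mD t : measurable (survive t) := measurable_survive t.
Let mC w k : measurable (cyl s0 w k : set T) := measurable_cyl w k.

Let pr_upd_blk y j b :
  pr (cyl s0 (upd y (j + n)%N b) (j + n).+1) = pr (cyl s0 y (j + n)) * P (y (j + n.-1)%N) b.
Proof. by rewrite -(prednK n_gt0) addnS; exact: pr_upd muP _ _ _. Qed.

Let birk_upd y j b : birk j.+1 (upd y (j + n)%N b) = birk j y + phi (it j y).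
Proof.
have h : agree (upd y (j + n)%N b) y (j + n) by exact: agree_upd.
rewrite birkS (birk_dep _ _ _ h); congr (_ + _).
by apply: phi_dep; exact: agree_shift.
Qed.

Let survive_dead t y j b : birk j y <= t -> ~ alive (upd y (j + n)%N b) j.+1 ->
  survive t `&` cyl s0 (upd y (j + n)%N b) (j + n).+1 = set0.
Proof.
move=> jt dead; apply/seteqP; split=> // z [sz zy]; apply: dead.
apply: (alive_dep j.+1 z); first by rewrite addSn.
apply: sz; rewrite (birk_dep _ _ y)//; apply: agree_trans (agree_upd y _ b).
by apply: agree_le zy.
Qed.

Let exp_split (a b e : R) : expR (s * (a + b - e)) = expR (s * (a - e)) * expR (s * b).
Proof. by rewrite -expRD -mulrDr addrAC. Qed.

(* Conditionally on the cylinder of [y], the martingale [exp (s S_j) g] keeps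
   its expectation until the word is completed or [S_j] exceeds [t]. *)
Let survive_cyl_le t k : forall y j, alive y j -> t - birk j y < c * k%:R ->
  gmin * pr (survive t `&` cyl s0 y (j + n)) <=
  expR (s * (birk j y - t)) * g y j * pr (cyl s0 y (j + n)).
Proof.
have past y j : alive y j -> t < birk j y ->
    gmin * pr (survive t `&` cyl s0 y (j + n)) <=
    expR (s * (birk j y - t)) * g y j * pr (cyl s0 y (j + n)).
  move=> al tj; apply: ler_pM => //; first exact: ltW.
    rewrite -[leLHS]mul1r ler_pM ?ler01 ?(ltW gmin_gt0) ?g_ge//.
    by rewrite -expR0 ler_expR mulr_ge0// subr_ge0 ltW.
  by apply: (pr_le _ _ _ pi_sum1 muP) => //; exact: measurableI.
elim: k => [|k ih] y j al hk; have [jt|tj] := leP (birk j y) t; try exact: past.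
  by exfalso; move: hk; rewrite mulr0; lra.
rewrite (pr_split _ _ _ pi_sum1 muP)// mulr_sumr.
apply: (@le_trans _ _ (\sum_b expR (s * (birk j y - t)) * (expR (s * phi (it j y)) *
    (P (y (j + n.-1)%N) b * g (upd y (j + n)%N b) j.+1)) * pr (cyl s0 y (j + n)))).
  apply: ler_sum => b _; set y' := upd y (j + n)%N b.
  have [al'|dead] := pselect (alive y' j.+1); last first.
    by rewrite survive_dead// g_dead// !(mulr0, mul0r) /pr measure0 mulr0.
  have := ih y' j.+1 al'; rewrite addSn pr_upd_blk birk_upd => h.
  apply: (le_trans (h _)).
    by move: hk; rewrite -natr1 mulrDr mulr1; have := phi_ge (it j y); lra.
  by rewrite le_eqVlt exp_split; apply/orP; left; apply/eqP; ring.
by rewrite -mulr_suml -mulr_sumr -mulr_sumr g_step.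
Qed.

(** One step overshoots [t] by at most [M]; measuring from [t + M] keeps the exponential weight
    below 1 when the process stops. *)
Let survive_cyl_ge t k : forall y j, alive y j -> birk j y <= t + M ->
  t - birk j y < c * k%:R ->
  expR (s * (birk j y - (t + M))) * g y j * pr (cyl s0 y (j + n)) <=
  gmax * pr (survive t `&` cyl s0 y (j + n)).
Proof.
have g0 y j : alive y j -> 0 <= g y j.
  by move=> al; exact: le_trans (ltW gmin_gt0) (g_ge _ _ al).
have past y j : alive y j -> birk j y <= t + M -> t < birk j y ->
    expR (s * (birk j y - (t + M))) * g y j * pr (cyl s0 y (j + n)) <=
    gmax * pr (survive t `&` cyl s0 y (j + n)).
  move=> al jM tj; have -> : survive t `&` cyl s0 y (j + n) = cyl s0 y (j + n).
    apply/setIidPr => z zy i it.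
    have ij : (i < j)%N.
      by apply: (birk_lt_idx _ _ z); rewrite (birk_dep j _ y)// (le_lt_trans it).
    by apply: (alive_le _ j) => //; apply: alive_dep al; exact: agree_sym.
  rewrite ler_wpM2r// -[leRHS]mul1r ler_pM ?expR_ge0 ?g0//.
  by rewrite -expR0 ler_expR mulr_ge0_le0// subr_le0.
elim: k => [|k ih] y j al jM hk; have [jt|tj] := leP (birk j y) t; try exact: past.
  by exfalso; move: hk; rewrite mulr0; lra.
rewrite (pr_split _ _ _ pi_sum1 muP)// mulr_sumr.
apply: (@le_trans _ _ (\sum_b expR (s * (birk j y - (t + M))) * (expR (s * phi (it j y)) *
    (P (y (j + n.-1)%N) b * g (upd y (j + n)%N b) j.+1)) * pr (cyl s0 y (j + n)))).
  by rewrite -mulr_suml -mulr_sumr -mulr_sumr g_step.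
apply: ler_sum => b _; set y' := upd y (j + n)%N b.
have [al'|dead] := pselect (alive y' j.+1); last first.
  by rewrite survive_dead// g_dead// !(mulr0, mul0r) /pr measure0 mulr0.
have := ih y' j.+1 al'; rewrite addSn pr_upd_blk birk_upd => h.
apply: le_trans (h _ _).
- by rewrite le_eqVlt exp_split; apply/orP; left; apply/eqP; ring.
- by have := phi_le (it j y); lra.
- by move: hk; rewrite -natr1 mulrDr mulr1; have := phi_ge (it j y); lra.
Qed.

Let alive0 y : alive y 0.
Proof. by move=> i; rewrite leqn0 addn_eq0 => /andP[_ /eqP L0]; have := L_gt0; rewrite L0. Qed.

(** The two cylinder estimates are used at step 0: the upper one on every [n]-cylinder, the lower
    one on that of [x] alone, which has positive measure. *)
Lemma survive_bounds : exists a b : R, [/\ 0 < a, 0 < b & forall t : R, 0 <= t ->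
  a * expR (- (s * t)) <= pr (survive t) /\ pr (survive t) <= b * expR (- (s * t))].
Proof.
have gmax0 : 0 < gmax by apply: lt_le_trans gmin_gt0 (le_trans (g_ge _ _ (alive0 x)) (g_le x 0)).
have prx : 0 < pr (cyl s0 x n).
  rewrite -(prednK n_gt0) (pr_cyl _ _ _ muP) mulr_gt0//.
  by apply: prodr_gt0 => i _; exact: Px.
have M0 : 0 <= M by apply: le_trans (ltW c_gt0) (le_trans (phi_ge (fun=> s0)) (phi_le _)).
exists (gmin / gmax * expR (- (s * M)) * pr (cyl s0 x n)), (gmax / gmin); split.
- by rewrite !mulr_gt0// ?expR_gt0// invr_gt0.
- by rewrite divr_gt0.
move=> t t0; have [k hk] := fuel_exists t.
have b0 y : birk 0 y = 0 by rewrite /birk big_ord0.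
split.
  have := @survive_cyl_ge t k x 0 (alive0 x); rewrite b0 sub0r subr0 => /(_ (addr_ge0 t0 M0) hk) h.
  rewrite -(ler_pM2l gmax0).
  apply: (@le_trans _ _ (gmax * pr (survive t `&` cyl s0 x n))); last first.
    by rewrite ler_pM2l// (pr_le _ _ _ pi_sum1 muP)//; exact: measurableI.
  apply: le_trans h; rewrite add0n.
  rewrite (_ : gmax * _ = expR (s * - (t + M)) * gmin * pr (cyl s0 x n)); last first.
    by rewrite mulrN mulrDr opprD expRD; field; rewrite gt_eqF.
  by rewrite ler_wpM2r// ler_wpM2l ?expR_ge0// g_ge.
apply: (pr_le_cyl _ _ _ pi_sum1 muP _ n) => // w.
have := @survive_cyl_le t k w 0 (alive0 w); rewrite b0 sub0r subr0 => /(_ hk) h.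
rewrite -(ler_pM2l gmin_gt0); apply: (le_trans h).
rewrite add0n mulrN mulrA ler_wpM2r// [leRHS]mulrA [leRHS](_ : _ = expR (- (s * t)) * gmax).
  by rewrite ler_wpM2l ?expR_ge0.
by field; rewrite gt_eqF.
Qed.

End SurvivalSet.

Lemma ln_rate_of_bounds {R : realType} (m : R -> R) (a b s : R) : 0 < a -> 0 < b ->
  (forall t, 0 <= t -> a * expR (- (s * t)) <= m t /\ m t <= b * expR (- (s * t))) ->
  (fun t => - (ln (m t) / t)) @ +oo --> s.
Proof.
move=> a0 b0 hm; apply/cvgrPdist_le => e e0.
pose K := `|ln a| + `|ln b|.
have K0 : 0 <= K by rewrite addr_ge0.
near=> t.
have t0 : 0 < t by near: t; exact: nbhs_pinfty_gt.
have tK : K / e <= t by near: t; apply: nbhs_pinfty_ge; rewrite num_real.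
have [h1 h2] := hm t (ltW t0).
have ae0 : 0 < a * expR (- (s * t)) by rewrite mulr_gt0 ?expR_gt0.
have be0 : 0 < b * expR (- (s * t)) by rewrite mulr_gt0 ?expR_gt0.
have mt0 : 0 < m t by exact: lt_le_trans h1.
have : ln (a * expR (- (s * t))) <= ln (m t) by rewrite ler_ln ?posrE.
have : ln (m t) <= ln (b * expR (- (s * t))) by rewrite ler_ln ?posrE.
rewrite !lnM ?posrE ?expR_gt0// !expRK => hb ha.
rewrite opprK -(ler_pM2r t0) -[X in `|_| * X](gtr0_norm t0) -normrM mulrDl divfK ?gt_eqF//.
move: tK; rewrite ler_pdivrMr// mulrC => tK; apply: le_trans tK.
have := ler_norm (ln b); have := ler_norm (- ln a); rewrite normrN.
have := normr_ge0 (ln b); have := normr_ge0 (ln a).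
rewrite ler_norml /K; move: ha hb; move: (`|ln a|) (`|ln b|) => *.
by apply/andP; split; lra.
Unshelve. all: by end_near. Qed.

(** * From the symbolic survival set to the special flow *)

Section Survivors.
Context {S : finType} {s0 : S} {R : realType}.
Local Notation T := (Sigma s0).
Variables (mu : {measure set T -> \bar R}) (n : nat) (phi : T -> R) (c M : R).
Local Notation it k y := (iter k (@sshift S) y).
Local Notation birk := (birk (@sshift S) phi).
Local Notation flow := (flow (@sshift S) phi).
Hypothesis phi_dep : forall y y' : T, agree y y' n -> phi y = phi y'.
Hypothesis c_gt0 : 0 < c.
Hypothesis phi_ge : forall y, c <= phi y.
Hypothesis phi_le : forall y, phi y <= M.

Let birk0 y : birk 0 y = 0. Proof. by rewrite /birk big_ord0. Qed.

Lemma NtE k t y : birk k y <= t -> t < birk k.+1 y -> Nt (@sshift S) phi t y = k.+1.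
Proof.
move=> kt tk; rewrite /Nt; set A := [set j | _].
have Ak : A k.+1.
  split=> // i; rewrite ltnS leq_eqVlt => /predU1P[->//|ik].
  exact: le_trans (ltW (birk_lt _ _ c_gt0 phi_ge _ _ _ ik)) kt.
have [h1 h2] := xgetPex 0%N (ex_intro A _ Ak); set j := xget _ _ in h1 h2 *.
have kj : (k < j)%N by apply: (birk_lt_idx _ _ c_gt0 phi_ge _ _ y); exact: le_lt_trans h1.
apply/eqP; rewrite eqn_leq kj andbT leqNgt; apply/negP => /h2.
by rewrite leNgt tk.
Qed.

Lemma flow_orbit y u tau : 0 <= u -> 0 <= tau ->
  exists k, (flow tau (y, u)).1 = it k y /\ birk k y <= tau + u.
Proof.
move=> u0 tau0; rewrite /Defs.flow; case: ifP => _.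
  by exists 0; rewrite birk0 addr_ge0.
have ex : exists m, u + tau < birk m y.
  exists (Num.truncn ((u + tau) / c)).+1; apply: lt_le_trans (birk_ge _ _ phi_ge _ _).
  by rewrite mulrC -ltr_pdivrMr//; exact: truncnS_gt.
case: (ex_minnP ex) => -[|k] hk hmin; first by move: hk; rewrite birk0; lra.
have kle : birk k y <= u + tau by rewrite leNgt; apply/negP => /hmin; rewrite ltnn.
by exists k; rewrite (NtE k)//= addrC.
Qed.

Lemma orbit_flow y u t k : 0 <= u -> u < phi y -> 0 <= t -> birk k y <= t + u ->
  exists tau, [/\ 0 <= tau, tau <= t & (flow tau (y, u)).1 = it k y].
Proof.
move=> u0 uphi t0; case: k => [|k] kt.
  by exists 0; rewrite /Defs.flow subr_gt0 uphi.
have b1 : phi y <= birk k.+1 y.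
  have -> : phi y = birk 1 y by rewrite /birk big_ord_recl big_ord0 addr0.
  case: k {kt} => // k; apply: ltW; exact: (birk_lt _ _ c_gt0 phi_ge).
(* The instant at which the trajectory of [(y, u)] lands on the base at the point of index
   [k.+1]. *)
exists (birk k.+1 y - u); split; [lra|lra|].
rewrite /Defs.flow ifF; last by apply/negbTE; rewrite -leNgt lerD2r.
rewrite [u + _]addrC subrK (NtE k.+1)//.
exact: (birk_lt _ _ c_gt0 phi_ge).
Qed.

(** A countable condition on the orbit replaces the uncountable one on [tau]; it gives measurability
    and the comparison with product sets. *)
Lemma survivorsE (A : set T) t : 0 <= t -> survivors (@sshift S) phi A t =
  [set ys : T * R | (0 <= ys.2 /\ ys.2 < phi ys.1) /\
     forall k, birk k ys.1 <= t + ys.2 -> ~ A (it k ys.1)].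
Proof.
move=> t0; apply/seteqP; split=> -[y u] /= [[u0 uphi] h]; split=> //.
  by move=> k kt; have [tau [h1 h2 <-]] := orbit_flow y u t k u0 uphi t0 kt; exact: h.
move=> tau tau0 taut; have [k [-> kt]] := flow_orbit y u tau u0 tau0.
by apply: h; apply: le_trans kt _; rewrite lerD2r.
Qed.

Lemma measurable_survivors w l (t : R) : 0 <= t ->
  measurable (survivors (@sshift S) phi (cyl s0 w l) t : set (T * R)).
Proof.
move=> t0; rewrite survivorsE//.
have mlt (f g : T * R -> R) : measurable_fun setT f -> measurable_fun setT g ->
    measurable [set z | f z < g z].
  move=> mf mg; rewrite -[X in measurable X]setTI.
  exact: (measurable_fun_ltr mf mg (@measurableT _ _) (Y := [set true])).
have mb k : measurable_fun setT (fun z : T * R => birk k z.1).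
  have mk : measurable_fun (setT : set T) (birk k : T -> R).
    by apply: (@measurable_fun_depends _ _ _ _ _ (k + n)) => y y'; exact: (birk_dep _ _ phi_dep).
  exact: (measurableT_comp mk measurable_fst).
have mphi : measurable_fun setT (fun z : T * R => phi z.1).
  have mk : measurable_fun (setT : set T) phi by exact: measurable_fun_depends phi_dep.
  exact: (measurableT_comp mk measurable_fst).
have msnd : measurable_fun setT (fun z : T * R => z.2) by exact: measurable_snd.
have -> : [set ys : T * R | (0 <= ys.2 /\ ys.2 < phi ys.1) /\
     forall k, birk k ys.1 <= t + ys.2 -> ~ cyl s0 w l (it k ys.1)] =
  (~` [set z | z.2 < 0] `&` [set z | z.2 < phi z.1]) `&`
  \bigcap_k ([set z | t + z.2 < birk k z.1] `|`
     (fst @^-1` (~` [set y : T | cyl s0 w l (it k y)]))).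
  apply/seteqP; split=> -[y u] /=.
    move=> [[u0 uphi] h]; split; first by split=> //; apply/negP; rewrite -leNgt.
    by move=> k _ /=; have [/h|] := leP (birk k y) (t + u); [right|left].
  move=> [[/negP]]; rewrite -leNgt => u0 uphi h; split=> // k kt.
  by case: (h k I) => //=; rewrite ltNge kt.
apply: measurableI; first apply: measurableI.
- by apply: measurableC; apply: mlt.
- exact: mlt.
- apply: bigcapT_measurable => k; apply: measurableU.
    by apply: mlt => //; exact: measurable_funD.
  rewrite -[X in measurable X]setTI; apply: measurable_fst => //.
  apply: measurableC; apply: (@measurable_depends _ _ _ (k + l)) => y y' h.
  apply: agree_trans; apply: agree_sym; exact: agree_shift.
Qed.

Context (P : S -> S -> R) (pi : S -> R) (x : nat -> S) (p N : nat).
Hypothesis pi_sum1 : \sum_a pi a = 1.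
Hypothesis muP : markov_measure P pi mu.
Local Notation L := (N * p)%N.
Hypothesis L_gt0 : (0 < L)%N.
Local Notation survive := (survive x n p N phi).
Local Notation surv := (survivors (@sshift S) phi (cyl s0 x (L + n))).

Lemma survivors_sub t : 0 <= t -> surv t `<=` survive t `*` `[0, M]%classic.
Proof.
move=> t0; rewrite survivorsE// => -[y u] /= [[u0 uphi] h]; split.
  move=> j jt i iL; apply: h; apply: (@le_trans _ _ (birk j y)).
    move: iL; rewrite -[i]addn0 -(prednK L_gt0) addn0 addnS ltnS => iL.
    have ij : (i <= j)%N by exact: leq_trans (leq_addr _ _) iL.
    move: ij; rewrite leq_eqVlt => /predU1P[->//|ij].
    exact/ltW/(birk_lt _ _ c_gt0 phi_ge).
  by apply: (le_trans jt); rewrite lerDl.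
by rewrite in_itv/= u0 (le_trans (ltW uphi)).
Qed.

(** An occurrence starting at [k] is complete at step [k + L], so it is detected through the index
    [k + L.-1]. The delay is at most [M * L], and the height adds at most [M]; heights below [c] lie
    under the ceiling at every point. *)
Lemma sub_survivors t : 0 <= t ->
  survive (t + (M + M * L%:R)) `*` `[0, c[%classic `<=` surv t.
Proof.
move=> t0; rewrite survivorsE// => -[y u] /= [sy]; rewrite in_itv/= => /andP[u0 uc].
split; first by split=> //; exact: lt_le_trans uc (phi_ge y).
move=> k kt hk; apply: (sy (k + L.-1)%N _ k) => //; last by rewrite -addnS prednK.
apply: (le_trans (birk_addn_le _ _ phi_le _ _ _)).
have M0 : 0 <= M by apply: le_trans (ltW c_gt0) (le_trans (phi_ge y) (phi_le y)).
have : M * L.-1%:R <= M * L%:R by rewrite ler_wpM2l// ler_nat leq_pred.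
have := phi_ge y; have := phi_le y; lra.
Qed.

(** The delay [B] only multiplies the lower constant by [exp (- s B)], which the exponential rate
    does not see. *)
Lemma escape_rate_of_survive_bounds (a b s : R) : 0 < a -> 0 < b ->
  (forall t : R, 0 <= t -> a * expR (- (s * t)) <= pr mu (survive t) /\
     pr mu (survive t) <= b * expR (- (s * t))) ->
  is_escape_rate mu (cyl s0 x (L + n)) phi s.
Proof.
move=> a0 b0 hab; pose B := M + M * L%:R.
have M0 : 0 < M by apply: lt_le_trans c_gt0 (le_trans (phi_ge x) (phi_le x)).
have B0 : 0 <= B by rewrite addr_ge0 ?mulr_ge0// ltW.
have mD t : measurable (survive t : set T) by exact: (measurable_survive _ _ _ _ _ _ phi_dep c_gt0 phi_ge).
apply: (@ln_rate_of_bounds _ _ (a * expR (- (s * B)) * c) (b * M)).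
- by rewrite !mulr_gt0 ?expR_gt0.
- by rewrite mulr_gt0.
move=> t t0.
have up : ((mu \x lebesgue_measure)%E (surv t) <= (pr mu (survive t) * M)%:E)%E.
  apply: (@le_trans _ _ ((mu \x lebesgue_measure)%E (survive t `*` `[0, M]%classic))).
    rewrite le_measure// ?inE; [exact: measurable_survivors| |exact: survivors_sub].
    exact: measurableX.
  by rewrite product_measure1E//= lebesgue_measure_itv/= lte_fin M0 (prE _ _ _ pi_sum1 muP)// -EFinD subr0 -EFinM.
have lo : ((pr mu (survive (t + B)) * c)%:E <= (mu \x lebesgue_measure)%E (surv t))%E.
  apply: (@le_trans _ _ ((mu \x lebesgue_measure)%E (survive (t + B) `*` `[0, c[%classic))).
    by rewrite product_measure1E//= lebesgue_measure_itv/= lte_fin c_gt0 (prE _ _ _ pi_sum1 muP)// -EFinD subr0 -EFinM.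
  rewrite le_measure// ?inE; [exact: measurableX|exact: measurable_survivors|exact: sub_survivors].
have fn : (mu \x lebesgue_measure)%E (surv t) \is a fin_num.
  by rewrite ge0_fin_numE ?measure_ge0// (le_lt_trans up)// ltry.
move: up lo; rewrite -(fineK fn) !lee_fin => up lo; split.
  apply: le_trans lo; have [h _] := hab (t + B) (addr_ge0 t0 B0).
  by rewrite mulrAC (ler_wpM2r (ltW c_gt0))// -mulrA -expRD -opprD -mulrDr addrC.
apply: (le_trans up); have [_ h] := hab t t0.
by rewrite mulrAC ler_wpM2r// ltW.
Qed.

End Survivors.

(** * Transition products along the periodic word *)

Section PeriodicWord.
Context {S : finType} {s0 : S} {R : realType}.
Local Notation T := (Sigma s0).
Variables (P : S -> S -> R) (x : nat -> S) (k p : nat).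
Local Notation n := (k.+1 * p)%N.
Local Notation it k y := (iter k (@sshift S) y).
Hypothesis p_gt0 : (0 < p)%N.
Hypothesis x_per : it p x = x.
Hypothesis Px : SigmaP P x.
Hypothesis P_ge0 : forall a b, 0 <= P a b.
Hypothesis P_sum1 : forall a, \sum_b P a b = 1.

Let xn i : x (i + n)%N = x i. Proof. exact: per_mul. Qed.

Let xn1 i : x (i + n.-1)%N = x (i + p.-1)%N.
Proof. by rewrite -[RHS](@per_mul _ x p x_per k); congr x; rewrite mulSn; lia. Qed.

(** As [n] is a multiple of [p], the left product starts one transition earlier on the same
    cycle. *)
Lemma prod_cycle : \prod_(i < p) P (x (i + n.-1)%N) (x (i + n)%N) = \prod_(i < p) P (x i) (x i.+1).
Proof.
under eq_bigr do rewrite xn1 xn.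
have xp i : x (i + p)%N = x i by rewrite -[p in (i + p)%N]mul1n per_mul.
case: p p_gt0 xp => // q _ xp; rewrite [LHS]big_ord_recl [RHS]big_ord_recr/= mulrC.
congr (_ * _); last by rewrite -(xp 0%N).
by apply: eq_bigr => i _; rewrite /bump/= add1n addSnnS xp.
Qed.

Lemma cycle_gainE (phi : T -> R) s : cycle_gain P x n p phi s =
  \prod_(i < p) P (x i) (x i.+1) * expR (s * birk (@sshift S) phi p x).
Proof.
by rewrite /cycle_gain /gain big_split/= prod_cycle mulrC -expR_sum mulr_sumr.
Qed.

Lemma stoch_le1 a b : P a b <= 1.
Proof. by rewrite -(P_sum1 a) (bigD1 b)//= lerDl sumr_ge0. Qed.

Lemma prod_cycle_le : \prod_(i < p) P (x i) (x i.+1) <= P (x (p.-1 + n.-1)%N) (x (p.-1 + n)%N).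
Proof.
rewrite -prod_cycle; case: p p_gt0 => // q _; rewrite big_ord_recr/=.
rewrite -[leRHS]mul1r ler_wpM2r//.
by rewrite -[leRHS](@big1 _ 1 *%R _ (index_enum 'I_q) xpredT (fun=> 1))//;
  apply: ler_prod => i _; rewrite P_ge0 stoch_le1.
Qed.

Lemma stoch_lt1 a b b' : b != b' -> 0 < P a b' -> P a b < 1.
Proof.
move=> bb' Pb'; rewrite -(P_sum1 a) (bigD1 b)//= (bigD1 b')/=; last by rewrite eq_sym.
by rewrite ltrDl ltr_pwDl// sumr_ge0.
Qed.

(* For [p = 1] being reduced only means that there is another letter, and
   irreducibility is needed. *)
Lemma reduced_last_lt1 : irreducible P -> reduced_word P x p ->
  P (x (p.-1 + n.-1)%N) (x (p.-1 + n)%N) < 1.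
Proof.
move=> irr [a [ax adm]]; rewrite xn xn1.
case: p p_gt0 x_per ax adm => [//|[|q]] _ per ax adm /=; last first.
  have -> : x (q.+1 + q.+1)%N = x q.
    by rewrite addSnnS -[in RHS]per iter_sshiftE addnC.
  have := adm q (ltnSn _); rewrite /= ltn_eqF// eqxx; apply: stoch_lt1.
  by apply/eqP => /esym.
rewrite addn0; have [l [pl ll]] := irr (x 0%N) a.
rewrite ltNge; apply/negP => P1; case: ax; rewrite -ll.
elim: l pl {ll} => //= b l ih /andP[Pb pl].
have [e|ne] := eqVneq b (x 0%N); first by rewrite e in pl *; exact: ih.
have : P (x 0%N) (x 0%N) < 1 by apply: stoch_lt1 Pb; rewrite eq_sym.
by rewrite ltNge P1.
Qed.

Variables (pi : S -> R) (mu : {measure set T -> \bar R}).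
Hypothesis muP : markov_measure P pi mu.

(** For [phi = 0] and [s = 0] the gains are bare transition probabilities, so the geometric law
    [WDmul] of the overlap weights also yields this power. *)
Lemma pr_cyl_periodic N : pr mu (cyl s0 x (N * p + n)) =
  (\prod_(i < p) P (x i) (x i.+1)) ^+ N * pr mu (cyl s0 x n).
Proof.
have n0 : (0 < n)%N by rewrite muln_gt0.
have g0 i : gain P x n (fun _ : T => 0 : R) 0 i = P (x (i + n.-1)%N) (x (i + n)%N).
  by rewrite /gain mul0r expR0 mul1r.
pose g := gain P x n (fun _ : T => 0 : R) 0.
have step m : pr mu (cyl s0 x (m + n)) = \prod_(i < m) g i * pr mu (cyl s0 x n).
  elim: m => [|m ih]; first by rewrite big_ord0 mul1r.
  rewrite big_ord_recr/= mulrAC -ih /g g0 addSn.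
  rewrite -[n in X in _ = pr mu (cyl _ _ X) * _](prednK n0) -[in LHS](prednK n0) !addnS.
  by rewrite !(pr_cyl _ _ _ muP) big_ord_recr/= mulrA -addnS prednK.
rewrite step; congr (_ * _).
have := @WDmul S s0 R P x n p (fun=> 0) x_per 0 0 N.
rewrite add0n cycle_gainE mul0r expR0 mulr1 /overlap_weight big_ord0 mul1r => /(congr1 GRing.inv).
by rewrite invrK => <-; rewrite -(big_morph _ (@invfM R) (@invr1 R)) invrK.
Qed.

End PeriodicWord.

(** * Assembly of the expansion *)

Lemma expr_eventually_le {R : realType} (c K e : R) : 0 < c -> c < 1 -> 0 <= K -> 0 < e ->
  exists N0, forall N, (N0 <= N)%N -> K * c ^+ N <= e.
Proof.
move=> c0 c1 K0 e0; have [M hM] := cube_mul_expr_bounded c c0 c1.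
exists (Num.truncn (K * M / e)).+1 => N hN.
have N0 : 0 < N%:R :> R by rewrite ltr0n; exact: leq_trans hN.
have KM : K * M / e <= N%:R.
  by apply/ltW/(lt_le_trans (truncnS_gt _)); rewrite ler_nat.
rewrite -(ler_pM2r N0); apply: (@le_trans _ _ (K * M)); last first.
  by rewrite [leRHS]mulrC -ler_pdivrMr.
rewrite -mulrA ler_wpM2l//; apply: le_trans (hM N).
rewrite mulrC ler_wpM2r ?exprn_ge0 ?(ltW c0)//.
by rewrite -[leLHS]expr1 ler_weXn2l// ler1n -(ltr0n R).
Qed.

Theorem theorem7p9 (R : realType) (S : finType) (s0 : S)
  (P : S -> S -> R) (pi : S -> R) (mu : {measure set (Sigma s0) -> \bar R})
  (beta : R) (x : Sigma s0) (p : nat) (phi : Sigma s0 -> R) :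
  stochastic P -> irreducible P -> stationary_prob P pi ->
  markov_measure P pi mu -> 0 < beta ->
  SigmaP P x ->
  (0 < p)%N -> iter p (@sshift S) x = x ->
  (forall q, (0 < q)%N -> (q < p)%N -> iter q (@sshift S) x <> x) ->
  reduced_word P x p ->
  local_escape_rate_exists mu beta x (fun=> 1) ->
  ceiling_fun phi -> cylinder_fun phi ->
  let A := fun nu : nat => cyl s0 x (nu * p) in
  let mu_ := fun nu : nat => fine (mu (A nu)) in
  let c_o := \prod_(i < p) P (x i) (x i.+1) in
  let K := (1 - c_o) / fine (\int[mu]_y (phi y)%:E) in
  let Spx := birk (@sshift S) phi p x in
  exists rho : nat -> R,
    (\forall nu \near \oo, is_escape_rate mu (A nu) phi (rho nu)) /\
    (fun nu => rho nu - (K * mu_ nu + K ^+ 2 * Spx * nu%:R * mu_ nu ^+ 2))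
      =o_\oo (fun nu => nu%:R * mu_ nu ^+ 2).
Proof.
move=> [P0 P1] irr [pi0 [pi1 stat]] muP _ Px p0 x_per x_min red _ [_ [c [c0 phi_ge]]] [m phi_m].
move=> A mu_ c_o K Spx.
(* A multiple of [p], at least [p] and at least the range [m] of [phi]; [m.+1] covers a constant
   [phi] with [m = 0]. *)
pose n := (m.+1 * p)%N.
have n0 : (0 < n)%N by rewrite muln_gt0.
have pn : (p <= n)%N by rewrite leq_pmull.
have mn : (m <= n)%N by rewrite /n (leq_trans (leqnSn m))// leq_pmulr.
have phi_dep (y y' : Sigma s0) : agree y y' n -> phi y = phi y'.
  by move=> h; apply: phi_m; exact: agree_le h.
have phi0 y : 0 <= phi y by exact: le_trans (ltW c0) (phi_ge y).
pose W := @word S s0 n.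
pose M := \sum_u phi (W u).
have phi_le y : phi y <= M.
  have -> : phi y = phi (W (block n y)) by apply: phi_dep => i ni; rewrite /W word_block.
  by rewrite /M (bigD1 (block n y))//= lerDl sumr_ge0.
have Ple a b : P a b <= 1 by exact: stoch_le1.
pose eta := P (x (p.-1 + n.-1)%N) (x (p.-1 + n)%N).
have eta0 : 0 <= eta by exact: P0.
have eta1 : eta < 1 by exact: (reduced_last_lt1 P x m p p0 x_per P0 P1 irr red).
have co0 : 0 < c_o by rewrite /c_o prodr_gt0//.
have co1 : c_o < 1 by apply: le_lt_trans eta1; exact: (prod_cycle_le P x m p p0 x_per P0 P1).
have sg0 : 0 <= Spx by rewrite /Spx /birk sumr_ge0.
pose w (u : {ffun 'I_n -> S}) b := P (lastl (s0 := s0) n u) b.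
pose pv (u : {ffun 'I_n -> S}) := pr mu (cyl s0 (W u) n).
have [s1 [C [B [F [s10 C0 B0 hF]]]]] := return_gf_exists (nxt (s0 := s0) n) w (block n x)
  (fun u b => P0 _ b) (fun u => P1 _) (reach_block P n n0 x irr Px) (fun u => phi (W u))
  (fun u => phi0 _) pv (fun u => pr_ge0 mu _) (block_stationary P n n0 pi mu stat muP).
pose ps := pr mu (cyl s0 x n).
have psE : pv (block n x) = ps.
  rewrite /pv /ps; congr pr; apply/seteqP; split=> y yx i ni; rewrite yx//.
    by rewrite /W word_block.
  by rewrite /W word_block.
have ps0 : 0 < ps.
  rewrite /ps -(prednK n0) (pr_cyl _ _ _ muP) mulr_gt0//.
  by apply: prodr_gt0 => i _; exact: Px.
pose mphi := fine (\int[mu]_y (phi y)%:E).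
have mphiE : mphi = \sum_u pv u * phi (W u) by exact: (integral_word P pi mu pi1 muP phi n phi_dep phi0).
have mphi0 : 0 < mphi.
  rewrite mphiE (bigD1 (block n x))//= ltr_pwDl//.
    by rewrite psE mulr_gt0// (lt_le_trans c0).
  by apply: sumr_ge0 => u _; rewrite mulr_ge0// pr_ge0.
pose d s := F s (block n x) - 1.
pose d0 := mphi / ps.
have d00 : 0 < d0 by rewrite divr_gt0.
have Bps0 : 0 <= B / ps by rewrite divr_ge0// ltW.
have d_lin s : 0 <= s -> s <= s1 -> `|d s - s * d0| <= B / ps * s ^+ 2.
  move=> s_ge0 ss1; have [_ _ + _] := hF s s_ge0 ss1; rewrite psE -mphiE => h.
  rewrite mulrAC ler_pdivlMr// -[X in _ * X](gtr0_norm ps0) -normrM.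
  by rewrite (_ : _ * ps = ps * d s - s * mphi)// /d0; field; rewrite gt_eqF.
have d_cont s : 0 <= s -> s <= s1 -> d t @[t --> s] --> d s.
  by move=> h1 h2; have [_ _ _ h] := hF s h1 h2; apply: cvgB; [exact: h|exact: cvg_cst].
have [r [K1 [N0 [K10 hr]]]] := root_asymptotics c_o Spx d0 s1 (B / ps) d
  co0 co1 sg0 d00 s10 Bps0 d_lin d_cont.
(* The martingale is at least [F - exp (s * Spx) * eta], hence at least
   [1 - eta - s * (C + 2 * Spx)]. Half of the gap [1 - eta] absorbs the last term for [N >= N1]; the
   other half is the lower bound. *)
pose e1 := (1 - eta) / 2.
have e10 : 0 < e1 by rewrite divr_gt0// subr_gt0.
have [N1 hN1] := expr_eventually_le c_o (K1 * (C + 2 * Spx)) e1 co0 co1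
  ltac:(by rewrite mulr_ge0// addr_ge0// mulr_ge0) e10.
have escape N : (0 < N)%N -> (N0 <= N)%N -> (N1 <= N)%N ->
    is_escape_rate mu (cyl s0 x (N * p + n)) phi (r N).
  move=> Npos /hr[rN0 rs1 rK root _] /hN1 small.
  set s := r N in rN0 rs1 rK root *.
  have [rec Fb _ _] := hF s (ltW rN0) rs1.
  have sC : s * (C + 2 * Spx) <= e1.
    apply: le_trans small; rewrite mulrAC ler_wpM2r//.
    by rewrite addr_ge0// mulr_ge0.
  have sCC : 0 <= s * C by rewrite mulr_ge0// ltW.
  have sS : 0 <= s * Spx by rewrite mulr_ge0// ltW.
  have es : expR (s * Spx) * eta <= eta + 2 * (s * Spx).
    have h1 : expR (s * Spx) - 1 <= 2 * (s * Spx).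
      apply: expR_sub1_le2 => //; move: sC; rewrite mulrDr /e1.
      by have := eta0; lra.
    apply: (@le_trans _ _ ((1 + 2 * (s * Spx)) * eta)); first by rewrite ler_wpM2r//; lra.
    by rewrite mulrDl mul1r lerD2l ler_piMr// ?mulr_ge0// ltW.
  have root' : (F s (block n x) - 1) *
      (\sum_(q < N) (cycle_gain P x n p phi s) ^- q.+1) = 1.
    by rewrite (cycle_gainE P x m p p0 x_per) -/(d s).
  pose g := mart P x n phi s (F s).
  have [a [b [a0 b0 hab]]] := @survive_bounds S s0 R P pi mu x n p N phi c M n0
    ltac:(by rewrite muln_gt0 Npos) pi0 pi1 muP Px phi_dep c0 phi_ge phi_le s g e1 (1 + C * s)
    (ltW rN0)
    (mart_step P x n p phi p0 pn Px phi_dep s (F s) rec)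
    (mart_dead P x n p phi p0 pn x_per x_min s (F s) N Npos root')
    ltac:(move=> y j al; have := mart_ge P x n p phi p0 pn x_per x_min Px s (F s) N Npos root'
            (ltW rN0) phi0 Ple y j al; rewrite -/(birk (@sshift S) phi p x) -/Spx -/eta -/g;
          have := Fb (blk n j y); rewrite ler_norml => /andP[hF1 _]; apply: le_trans;
          move: sC es; rewrite mulrDr /e1; lra)
    ltac:(move=> y j; apply: le_trans (mart_le P x n p phi p0 pn Px s (F s) N Npos root' y j) _;
          have := Fb (blk n j y); rewrite ler_norml => /andP[_ hF1]; lra)
    e10.
  exact: (escape_rate_of_survive_bounds mu n phi c M phi_dep c0 phi_ge phi_le P pi x p N pi1 muP
    ltac:(by rewrite muln_gt0 Npos) a b s a0 b0 hab).
have nu_split nu : (m.+1 <= nu)%N -> (nu * p = (nu - m.+1) * p + n)%N.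
  by move=> h; rewrite /n -mulnDl subnK.
(* The first [m.+1] periods form the [n]-block; the remaining ones are the [N] of the equation. *)
exists (fun nu => r (nu - m.+1)%N); split.
  exists (m.+1 + (N0 + N1).+1)%N => //= nu /= hnu.
  have h : [/\ (m.+1 <= nu)%N, (0 < nu - m.+1)%N, (N0 <= nu - m.+1)%N & (N1 <= nu - m.+1)%N].
    by move: hnu; clear; split; lia.
  by case: h => h1 h2 h3 h4; rewrite /A (nu_split _ h1); exact: escape.
apply/eqoP => eps eps0.
(* Two errors of order [X ^+ 2] must be absorbed: that of the root, with constant [K1], and the
   change from [N] to [nu] in the second term. *)
have [N2 hN2] : exists N2 : nat, K1 + ((1 - c_o) / d0) ^+ 2 * Spx * m.+1%:R <= eps * ps ^+ 2 * N2%:R.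
  have h : 0 < eps * ps ^+ 2 by rewrite mulr_gt0// exprn_gt0.
  exists (Num.truncn ((K1 + ((1 - c_o) / d0) ^+ 2 * Spx * m.+1%:R) / (eps * ps ^+ 2))).+1.
  by rewrite [leRHS]mulrC -ler_pdivrMr//; exact/ltW/truncnS_gt.
exists (m.+1 + (N0 + N2).+1)%N => //= nu /= hnu.
have mnu : (m.+1 <= nu)%N by move: hnu; clear; lia.
have [N nuE] : exists N, nu = (N + m.+1)%N by exists (nu - m.+1)%N; rewrite subnK.
rewrite nuE addnK.
have hN : (N0 <= N)%N by move: hnu; rewrite nuE; clear; lia.
have [rN0 rs1 rK root asy] := hr N hN.
have muE : mu_ (N + m.+1)%N = c_o ^+ N * ps.
  rewrite /mu_ /A nu_split ?leq_addl// addnK -/(pr mu _).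
  exact: (pr_cyl_periodic P x m p p0 x_per pi mu muP).
rewrite muE.
set X := c_o ^+ N in asy *.
have X0 : 0 <= X ^+ 2 by exact: sqr_ge0.
set aa := (1 - c_o) / d0 in asy hN2 *.
(* The measure [ps] of the [n]-block cancels: [K * mu_nu] is [aa * X], the leading term of the
   root. *)
have KE : K = aa / ps by rewrite /K /aa /d0 -/mphi; field; rewrite !gt_eqF.
rewrite [leRHS](_ : _ = eps * ps ^+ 2 * (N + m.+1)%:R * X ^+ 2); last first.
  by rewrite ger0_norm; [ring|rewrite mulr_ge0// sqr_ge0].
apply: (@le_trans _ _ ((K1 + aa ^+ 2 * Spx * m.+1%:R) * X ^+ 2)); last first.
  rewrite ler_wpM2r//; apply: (le_trans hN2); rewrite ler_wpM2l ?ler_nat//.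
    by rewrite mulr_ge0 ?sqr_ge0// ltW.
  by move: hnu; rewrite nuE; clear; lia.
rewrite (_ : r N - _ = (r N - (aa * X + aa ^+ 2 * Spx * N%:R * X ^+ 2)) -
    aa ^+ 2 * Spx * m.+1%:R * X ^+ 2); last first.
  by rewrite KE natrD; field; rewrite gt_eqF.
apply: (le_trans (ler_normB _ _)); rewrite mulrDl lerD//.
have t0 : 0 <= aa ^+ 2 * Spx * m.+1%:R by rewrite mulr_ge0// mulr_ge0// sqr_ge0.
by rewrite ger0_norm// (mulr_ge0 t0).
Qed.
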